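(* Let $\sigma^2 \in [0,\infty)$ and let $a=(a_n)_{n\in\mathbb{N}}$ be a sequence of strictly positive reals. Let $\gamma\in\mathbb{R}$ and let $(\beta_n)_{n\in\mathbb{N}}\subseteq\mathbb{R}$ satisfy $\lim_{n\to\infty} n(1-\beta_n)=\gamma$. Let $\varepsilon=(\varepsilon_k)_{k\in\mathbb{N}}$ be a sequence of random variables and let $(X_0^{(n)})_{n\in\mathbb{N}}$ be random variables with $X_0^{(n)}=o_P(a_n)$ as $n\to\infty$. For each $n\ge 1$ let $X^{(n)}$ be the nearly unstable model $$X_t^{(n)}=\beta_n X_{t-1}^{(n)}+\varepsilon_t,\qquad t=1,\dots,n,$$ with initial value $X_0^{(n)}$, and define $$\hat b_n=\frac{\sum_{t=0}^{n-1}X_{t+1}^{(n)}X_t^{(n)}}{\sum_{t=0}^{n-1}(X_t^{(n)})^2},\qquad \hat\tau_n=\Big(\sum_{t=0}^{n-1}(X_t^{(n)})^2\Big)^{1/2}(\hat b_n-\beta_n).$$ Then: (i) If $\lim_{n\to\infty}n^{-1/2}a_n=\infty$ and $(\varepsilon,Z)\in\mathrm{DA}(a)$, then as $n\to\infty$ $$\begin{pmatrix} a_n^{-1}n^{1/2}\hat\tau_n\\ n(\hat b_n-\beta_n)\end{pmatrix}\xrightarrow{d}\Big(\frac{Z_{\gamma,1}^2}{2}+\gamma\int_0^1 Z_{\gamma,s}^2\,ds\Big)\Theta(Z_\gamma).$$ (ii) If $\lim_{n\to\infty}n^{-1/2}a_n=1$ and $(\varepsilon,Z)\in\mathrm{DA}'(a,\sigma^2)$,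 then as $n\to\infty$ $$\begin{pmatrix} \hat\tau_n\\ n(\hat b_n-\beta_n)\end{pmatrix}\xrightarrow{d}\Big(\frac{Z_{\gamma,1}^2-\sigma^2}{2}+\gamma\int_0^1 Z_{\gamma,s}^2\,ds\Big)\Theta(Z_\gamma).$$ (iii) If $\lim_{n\to\infty}n^{-1/2}a_n=0$ and $(\varepsilon,Z)\in\mathrm{DA}'(a,\sigma^2)$, then as $n\to\infty$ $$\begin{pmatrix} a_n n^{-1/2}\hat\tau_n\\ a_n^2(\hat b_n-\beta_n)\end{pmatrix}\xrightarrow{d}-\frac{\sigma^2}{2}\Theta(Z_\gamma).$$
   Context: $D$ denotes the space of càdlàg functions $f:[0,1]\to\mathbb{R}$ with the Skorokhod topology and its Borel $\sigma$-algebra; $\xrightarrow{d}$ denotes convergence in distribution (weak convergence). For a sequence $c=(c_n)$ of positive reals, write $(\varepsilon,Z)\in\mathrm{DA}(c)$ if $\varepsilon=(\varepsilon_k)_{k\in\mathbb{N}}$ is a sequence of random variables and $Z$ is a $D$-valued random variable such that: (D1) $c_n^{-1}\sum_{k=1}^{[n\cdot]}\varepsilon_k\xrightarrow{d}Z$ in $D$ as $n\to\infty$; (D2) $P(Z(t)=0\ \forall t\in[0,1])=0$; (D3) $\sum_{k=1}^n\varepsilon_k^2=o_P(c_n^2)$ as $n\to\infty$. For $\sigma^2\ge 0$, write $(\varepsilon,Z)\in\mathrm{DA}'(c,\sigma^2)$ if (D1) and (D2) hold and (D3)' $n^{-1}\sum_{k=1}^n\varepsilon_k^2=\sigma^2+o_P(1)$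 as $n\to\infty$. For a $D$-valued $Z$ and $\gamma\in\mathbb{R}$, the Ornstein–Uhlenbeck process driven by $Z$ is $Z_{\gamma,t}=Z_t-\gamma\int_0^t e^{-\gamma(t-s)}Z_s\,ds$, $t\in[0,1]$. For $Z$ satisfying (D2), $\Theta(Z)$ denotes the random vector $\big((\int_0^1 Z_s^2ds)^{-1/2},\ (\int_0^1Z_s^2ds)^{-1}\big)^T$. *)

(* Defs.v *)
From HB Require Import structures.
From mathcomp Require Import all_boot all_order all_algebra.
From mathcomp Require Import all_classical all_reals all_analysis.
Set Implicit Arguments. Unset Strict Implicit. Unset Printing Implicit Defensive.
Import Order.TTheory GRing.Theory Num.Theory.
Import numFieldNormedType.Exports.
Local Open Scope classical_set_scope.
Local Open Scope ring_scope.

Section Defs.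
Variable R : realType.

(* f is cadlag on [0,1]: right-continuous on [0,1), left limits on (0,1].
   Elements of D are represented by functions R -> R; only their values on
   [0,1] matter (the Skorokhod distance only looks at [0,1]). *)
Definition cadlag (f : R -> R) : Prop :=
  (forall t, 0 <= t -> t < 1 -> f x @[x --> t^'+] --> f t) /\
  (forall t, 0 < t -> t <= 1 -> cvg (f x @[x --> t^'-])).

Definition time_change (l : R -> R) : Prop :=
  {within `[0, 1], continuous l} /\
  (forall x y, 0 <= x -> x < y -> y <= 1 -> l x < l y) /\
  l 0 = 0 /\ l 1 = 1.

Definition skorokhod_dist (f g : R -> R) : R :=
  inf [set Num.max (sup [set `|l t - t| | t in `[0, 1]])
                   (sup [set `|f t - g (l t)| | t in `[0, 1]]) | l in time_change].

(* open sets of D for the Skorokhod topology (traces on D of subsets of R -> R) *)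
Definition skorokhod_open (U : set (R -> R)) : Prop :=
  forall f, cadlag f -> U f ->
    exists2 del : R, 0 < del &
      forall g, cadlag g -> skorokhod_dist f g < del -> U g.

Definition skorokhod_borel : set (set (R -> R)) :=
  <<s [set U | skorokhod_open U] >>.

Definition skorokhod_continuous (F : (R -> R) -> R) : Prop :=
  forall f, cadlag f -> forall e : R, 0 < e ->
    exists2 del : R, 0 < del &
      forall g, cadlag g -> skorokhod_dist f g < del -> `|F f - F g| < e.

Definition D_random_variable (d : measure_display) (T : measurableType d)
  (Z : T -> R -> R) : Prop :=
  (forall w, cadlag (Z w)) /\
  (forall B, skorokhod_borel B -> measurable (Z @^-1` B)).

Definition cvg_dist_D (d : measure_display) (T : measurableType d)
  (P : probability T R) (Y : nat -> T -> R -> R)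
  (d' : measure_display) (T' : measurableType d') (P' : probability T' R)
  (Z : T' -> R -> R) : Prop :=
  forall F : (R -> R) -> R, skorokhod_continuous F ->
    (exists M : R, forall f, cadlag f -> `|F f| <= M) ->
    (\int[P]_w (F (Y n w))%:E)%E @[n --> \oo] --> (\int[P']_w (F (Z w))%:E)%E.

Definition cvg_dist_R2 (d : measure_display) (T : measurableType d)
  (P : probability T R) (Y : nat -> T -> R * R)
  (d' : measure_display) (T' : measurableType d') (P' : probability T' R)
  (W : T' -> R * R) : Prop :=
  forall F : R * R -> R, continuous F ->
    (exists M : R, forall x, `|F x| <= M) ->
    (\int[P]_w (F (Y n w))%:E)%E @[n --> \oo] --> (\int[P']_w (F (W w))%:E)%E.

Definition small_oP (d : measure_display) (T : measurableType d)
  (P : probability T R) (X : nat -> T -> R) (c : nat -> R) : Prop :=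
  forall eta : R, 0 < eta ->
    P [set w | eta * c n < `|X n w|] @[n --> \oo] --> 0%E.

Definition partial_sum_process (d : measure_display) (T : measurableType d)
  (c : nat -> R) (eps : nat -> T -> R) (n : nat) (w : T) : R -> R :=
  fun t => (c n)^-1 * \sum_(1 <= k < (Num.truncn (n%:R * t)).+1) eps k w.

Definition DA (d : measure_display) (T : measurableType d) (P : probability T R)
  (c : nat -> R) (eps : nat -> T -> R)
  (d' : measure_display) (T' : measurableType d') (P' : probability T' R)
  (Z : T' -> R -> R) : Prop :=
  D_random_variable Z /\
  cvg_dist_D P (partial_sum_process c eps) P' Z /\
  P' [set w | forall t, 0 <= t <= 1 -> Z w t = 0] = 0%E /\
  small_oP P (fun n w => \sum_(1 <= k < n.+1) eps k w ^+ 2) (fun n => c n ^+ 2).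

Definition DA' (d : measure_display) (T : measurableType d) (P : probability T R)
  (c : nat -> R) (sigma2 : R) (eps : nat -> T -> R)
  (d' : measure_display) (T' : measurableType d') (P' : probability T' R)
  (Z : T' -> R -> R) : Prop :=
  D_random_variable Z /\
  cvg_dist_D P (partial_sum_process c eps) P' Z /\
  P' [set w | forall t, 0 <= t <= 1 -> Z w t = 0] = 0%E /\
  (forall eta : R, 0 < eta ->
    P [set w | eta < `|n%:R^-1 * \sum_(1 <= k < n.+1) eps k w ^+ 2 - sigma2|]
      @[n --> \oo] --> 0%E).

Definition OU (gamma : R) (f : R -> R) : R -> R :=
  fun t => f t - gamma *
    Rintegral (@lebesgue_measure R) `[0, t] (fun s => expR (- gamma * (t - s)) * f s).

Definition sq_int (f : R -> R) : R :=
  Rintegral (@lebesgue_measure R) `[0, 1] (fun s => f s ^+ 2).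

Definition Theta (f : R -> R) : R * R :=
  ((Num.sqrt (sq_int f))^-1, (sq_int f)^-1).

Definition scaleR2 (c : R) (v : R * R) : R * R := (c * v.1, c * v.2).

Fixpoint ar1 (beta x0 : R) (e : nat -> R) (t : nat) : R :=
  match t with
  | 0 => x0
  | t'.+1 => beta * ar1 beta x0 e t' + e t'.+1
  end.

Definition Xn (d : measure_display) (T : measurableType d)
  (beta : nat -> R) (X0 : nat -> T -> R) (eps : nat -> T -> R)
  (n : nat) (w : T) (t : nat) : R :=
  ar1 (beta n) (X0 n w) (fun k => eps k w) t.

Definition bhat (d : measure_display) (T : measurableType d)
  (beta : nat -> R) (X0 : nat -> T -> R) (eps : nat -> T -> R)
  (n : nat) (w : T) : R :=
  (\sum_(t < n) Xn beta X0 eps n w t.+1 * Xn beta X0 eps n w t) /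
  (\sum_(t < n) Xn beta X0 eps n w t ^+ 2).

Definition tauhat (d : measure_display) (T : measurableType d)
  (beta : nat -> R) (X0 : nat -> T -> R) (eps : nat -> T -> R)
  (n : nat) (w : T) : R :=
  Num.sqrt (\sum_(t < n) Xn beta X0 eps n w t ^+ 2) * (bhat beta X0 eps n w - beta n).

End Defs.

(* Main.v *)
Require Import Defs.
From HB Require Import structures.
From mathcomp Require Import all_boot all_order all_algebra.
From mathcomp Require Import all_classical all_reals all_analysis.
From mathcomp Require Import measurable_realfun ring lra.
Import Order.TTheory GRing.Theory Num.Theory.
Import numFieldNormedType.Exports.
Local Open Scope classical_set_scope.
Local Open Scope ring_scope.

(** On the grid k/n the Ornstein-Uhlenbeck transform of the normalised partial-sum
    process satisfies an AR(1) recursion with the same innovations as the model and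
    with coefficient exp(-gamma/n) instead of beta_n. Hence X_n/a_n and the
    normalised sum of squares of X are close in probability to OU(V_n)(1) and to the
    integral of OU(V_n)^2, which are Skorokhod-continuous functionals of the
    partial-sum process V_n. Squaring the recursion and summing expresses
    2 beta_n (sum of X_t eps_(t+1)) through X_n^2 - X_0^2, the sum of squares of X
    and the sum of squares of the innovations; this yields the numerator of
    bhat - beta_n, and the three cases differ only by the norming of that identity.
    The denominator does not vanish in the limit: if the integral of OU(Z)^2 is zero,
    then Z vanishes on [0,1), so by (D2) it is a single jump at time 1. Such a jump
    is excluded in case (i) by the smallness of the last innovation (D3), and in
    cases (ii), (iii) because it would force a_n to grow exponentially, whereas
    a_n = O(n^(1/2)). *)

(** * Càdlàg functions *)

(** Convergence in D is given only through bounded Skorokhod-continuous functionals, while the limit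
    law involves a quotient that is neither bounded nor continuous. For a bounded continuous test
    function [F] on the plane, the quotient is cut off where its denominator falls below some [del];
    the result is a bounded Skorokhod-continuous functional, to which (D1) applies directly. The
    true statistic is close to the cut-off functional of [V_n] outside four events: large path,
    large initial value, large error in the sum of squared innovations, small denominator. Outside
    them the comparison of model and path is deterministic, with a threshold in n that does not
    depend on the sample point; this is why the estimates are stated for arbitrary real sequences.
    The supremum over [0,1) and the value at 1 are treated as two functionals throughout. Both are
    Skorokhod-continuous because time changes fix 1, and only in this split form can a path
    concentrated at time 1 be recognised and excluded. *)

Section CadlagPartition.
Context {R : realType}.
Implicit Types (f g : R -> R) (e : R).
Notation mu := (@lebesgue_measure R).

(** The classical partition of a càdlàg path into cells of small oscillation, as an inductive
    predicate rather than a list of cut points, so that its consequences become inductions. Cells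
    are open on the right, since the path may jump there. *)
Inductive fin_osc f e : R -> R -> Prop :=
| fin_osc_base a b : a <= b ->
    (forall x y, a <= x < b -> a <= y < b -> `|f x - f y| <= e) ->
    fin_osc f e a b
| fin_osc_trans a b c : fin_osc f e a b -> fin_osc f e b c -> fin_osc f e a c.

Lemma cadlag_right f t e : cadlag f -> 0 <= t -> t < 1 -> 0 < e ->
  exists2 del, 0 < del & forall x, t <= x < t + del -> `|f t - f x| <= e.
Proof.
move=> [rc _] t0 t1 e0.
have /cvgrPdist_le/(_ e e0)[del /= del0 H] := rc t t0 t1.
exists del => // x /andP[]; rewrite le_eqVlt => /predU1P[<- _|tx xd].
  by rewrite subrr normr0 ltW.
by apply: H => //=; rewrite ltr_distlC; apply/andP; split; lra.
Qed.

Lemma cadlag_left f t e : cadlag f -> 0 < t -> t <= 1 -> 0 < e ->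
  exists2 del, 0 < del &
    forall x y, t - del < x < t -> t - del < y < t -> `|f x - f y| <= e.
Proof.
move=> [_ ll] t0 t1 e0.
have e20 : 0 < e / 2 by lra.
have /cvg_ex[l /cvgrPdist_le/(_ _ e20)[del /= del0 H]] := ll t t0 t1.
exists del => // x y /andP[xd xt] /andP[yd yt].
have Hx : `|l - f x| <= e / 2.
  by apply: H => //=; rewrite ltr_distlC; apply/andP; split; lra.
have Hy : `|l - f y| <= e / 2.
  by apply: H => //=; rewrite ltr_distlC; apply/andP; split; lra.
have -> : f x - f y = (l - f y) - (l - f x) by ring.
by rewrite (le_trans (ler_normB _ _))//; lra.
Qed.

(** The left limit at the supremum of the reachable right ends makes this supremum reachable; if it
    were below 1, right-continuity would move it further. *)
Lemma cadlag_fin_osc f e : cadlag f -> 0 < e -> fin_osc f e 0 1.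
Proof.
move=> cf e0; pose A := [set t | t <= 1 /\ fin_osc f e 0 t].
have e20 : 0 < e / 2 by lra.
have A0 : A 0.
  by split=> //; apply: fin_osc_base => // x y /andP[? ?]; lra.
have A1 : ubound A 1 by move=> t [].
have supA : has_sup A by split; [exists 0|exists 1].
have s0 : 0 <= sup A by apply: ub_le_sup => //; exists 1.
have s1 : sup A <= 1 by apply: ge_sup => //; exists 0.
have As : fin_osc f e 0 (sup A).
  move: s0; rewrite le_eqVlt => /predU1P[<-|s0]; first by case: A0.
  have [del del0 H] := cadlag_left f _ e cf s0 s1 e0.
  have [t [t1 ft] ts] := sup_adherent del0 supA.
  have tsA : t <= sup A by apply: ub_le_sup => //; exists 1.
  apply: fin_osc_trans ft _; apply: fin_osc_base => // x y /andP[? ?] /andP[? ?].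
  by apply: H; apply/andP; split; lra.
have [s_lt1|] := ltP (sup A) 1; last first.
  by move=> s_ge1; rewrite -[X in fin_osc _ _ _ X](@le_anti _ _ (sup A) 1)// s1.
have [del del0 H] := cadlag_right f _ _ cf s0 s_lt1 e20.
pose t := Num.min 1 (sup A + del).
have st : sup A < t by rewrite lt_min s_lt1/= ltrDl.
suff At : A t.
  have : t <= sup A by apply: ub_le_sup => //; exists 1.
  by rewrite leNgt st.
split; first by rewrite ge_min lexx.
apply: fin_osc_trans As _; apply: fin_osc_base; first exact: ltW.
have tE : t <= sup A + del by rewrite ge_min lexx orbT.
move=> x y /andP[sx xt] /andP[sy yt].
have Hx : `|f (sup A) - f x| <= e / 2 by apply: H; rewrite sx/=; lra.
have Hy : `|f (sup A) - f y| <= e / 2 by apply: H; rewrite sy/=; lra.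
have -> : f x - f y = (f (sup A) - f y) - (f (sup A) - f x) by ring.
by rewrite (le_trans (ler_normB _ _))//; lra.
Qed.

Lemma fin_osc_bounded f e a b : fin_osc f e a b ->
  exists M, forall x, a <= x < b -> `|f x| <= M.
Proof.
elim=> {a b} [a b ab H|a b c _ [M HM] _ [K HK]].
  exists (`|f a| + e) => x /andP[ax xb].
  have -> : f x = f a + (f x - f a) by ring.
  rewrite (le_trans (ler_normD _ _))// lerD2l H ?ax ?lexx//=.
  exact: le_lt_trans xb.
exists (Num.max M K) => x /andP[ax xc]; rewrite le_max.
by have [xb|bx] := ltP x b; [rewrite HM ?ax|rewrite HK ?bx ?orbT].
Qed.

Lemma cadlag_bounded f : cadlag f ->
  exists2 M, 0 < M & forall x, 0 <= x <= 1 -> `|f x| <= M.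
Proof.
move=> cf; have [M HM] := @fin_osc_bounded f 1 0 1 (cadlag_fin_osc f 1 cf ltr01).
(* The partition covers [[0, 1)] only, so the value at 1 enters separately. *)
exists (`|M| + `|f 1| + 1) => [|x /andP[x0]]; first by rewrite ltr_pwDr// addr_ge0.
rewrite le_eqVlt => /predU1P[->|x1].
  by have := normr_ge0 M; lra.
have := HM x; rewrite x0 x1 => /(_ isT).
by have := normr_ge0 (f 1); have := ler_norm M; lra.
Qed.

Lemma fin_osc_approx f e a b : fin_osc f e a b ->
  exists2 g : R -> R, measurable_fun setT g & forall x, a <= x < b -> `|f x - g x| <= e.
Proof.
elim=> {a b} [a b ab H|a b c _ [g mg Hg] _ [h mh Hh]].
  exists (cst (f a)) => // x /andP[ax xb] /=.
  by rewrite H ?ax ?xb ?lexx//=; exact: le_lt_trans xb.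
exists (fun x => if x < b then g x else h x).
  apply: measurable_fun_ifT => //.
  exact: measurable_fun_ltr.
move=> x /andP[ax xc]; case: ltP => xb; first by rewrite Hg ?ax.
by rewrite Hh ?xb.
Qed.

(** On [[0, 1]] the path is a uniform limit of the step functions coming from the partitions with
    oscillation [1 / (n + 1)], patched at 1. *)
Lemma cadlag_measurable f : cadlag f -> measurable_fun (`[0, 1] : set R) f.
Proof.
move=> cf.
have Hn n : exists g : R -> R, measurable_fun setT g /\
    forall x, 0 <= x <= 1 -> `|f x - g x| <= n.+1%:R^-1.
  have n0 : 0 < n.+1%:R^-1 :> R by rewrite invr_gt0.
  have [g mg Hg] := fin_osc_approx _ _ _ _ (cadlag_fin_osc f _ cf n0).
  exists (fun x => if x < 1 then g x else f 1); split.
    by apply: measurable_fun_ifT => //; exact: measurable_fun_ltr.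
  move=> x /andP[x0 x1]; case: ltP => [xl1|x1']; first by rewrite Hg// x0.
  have -> : x = 1 by apply/le_anti/andP.
  by rewrite subrr normr0 ltW.
pose g n := projT1 (cid (Hn n)).
have [mg Hg] : (forall n, measurable_fun setT (g n)) /\
    (forall n x, 0 <= x <= 1 -> `|f x - g n x| <= n.+1%:R^-1).
  by split=> n; rewrite /g; case: cid => /= ? [].
apply: (@measurable_fun_cvg _ _ R _ g f).
  by move=> n; apply: measurable_funTS.
move=> x /=; rewrite in_itv/= => x01.
apply/cvgrPdist_le => e e0.
near=> n.
rewrite (le_trans (Hg n x x01))// ltW//.
by near: n; exact: near_infty_natSinv_lt (PosNum e0).
Unshelve. all: by end_near. Qed.

(** The exceptional set consists of neighbourhoods of the cut points: a point outside it stays in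
    its cell under any shift below [del]. *)
Lemma fin_osc_bad_set f e a b eta : fin_osc f e a b -> 0 < eta ->
  exists del B, [/\ 0 < del, measurable B, (mu B <= eta%:E)%E &
    forall u t, a <= u < b -> ~ B u -> `|t - u| < del -> `|f t - f u| <= e].
Proof.
move=> fo; elim: fo eta => {a b} [a b ab H eta eta0|a b c _ IH1 _ IH2 eta eta0].
  have mI x : mu `[x - eta / 4, x + eta / 4]%classic = (eta / 2)%:E.
    rewrite lebesgue_measure_itv/= lte_fin ifT; last lra.
    by rewrite -EFinB; congr EFin; lra.
  (* Two intervals of length [eta / 2] around the end points use up the measure [eta]. *)
  exists (eta / 4), (`[a - eta / 4, a + eta / 4] `|` `[b - eta / 4, b + eta / 4]).
  split; first lra.
  - by apply: measurableU; exact: measurable_itv.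
  - have H2 (A B : set R) : measurable A -> measurable B ->
        (mu (A `|` B) <= mu A + mu B)%E by move=> mA mB; exact: measureU2.
    apply: (le_trans (H2 _ _ _ _)); try exact: measurable_itv.
    by rewrite !mI -EFinD lee_fin; lra.
  - move=> u t /andP[au ub] nB; rewrite ltr_distl => /andP[t1 t2].
    have ua : a + eta / 4 < u.
      by rewrite ltNge; apply/negP => h; apply: nB; left => /=;
         rewrite in_itv/=; apply/andP; split; lra.
    have bu : u < b - eta / 4.
      by rewrite ltNge; apply/negP => h; apply: nB; right => /=;
         rewrite in_itv/=; apply/andP; split; lra.
    by apply: H; apply/andP; split; lra.
have eta20 : 0 < eta / 2 by lra.
have [d1 [B1 [d10 mB1 B1e H1]]] := IH1 _ eta20.
have [d2 [B2 [d20 mB2 B2e H2]]] := IH2 _ eta20.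
exists (Num.min d1 d2), (B1 `|` B2); split.
- by rewrite lt_min d10.
- exact: measurableU.
- apply: le_trans; first exact: measureU2.
  rewrite (_ : eta = eta / 2 + eta / 2); last lra.
  by rewrite EFinD leeD.
- move=> u t /andP[au uc] nB; rewrite lt_min => /andP[td1 td2].
  have [ub|bu] := ltP u b.
    by apply: H1; rewrite ?au//; move=> ?; apply: nB; left.
  by apply: H2; rewrite ?bu//; move=> ?; apply: nB; right.
Qed.

End CadlagPartition.

(** * Integrals of bounded measurable functions over subintervals of [0,1] *)

Section UnitIntervalIntegral.
Context {R : realType}.
Implicit Types (f g : R -> R) (a b c e : R).
Notation mu := (@lebesgue_measure R).

Definition iint f a b := Rintegral mu `[a, b] f.

(** A class stable under the operations needed later, so that integrability is settled once, in
    [bdm_integrable]. *)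
Definition bdm f := measurable_fun (`[0, 1] : set R) f /\
  exists M, forall x, 0 <= x <= 1 -> `|f x| <= M.

Lemma cadlag_bdm f : cadlag f -> bdm f.
Proof.
move=> cf; split; first exact: cadlag_measurable.
by have [M _ HM] := cadlag_bounded f cf; exists M.
Qed.

Lemma bdmM f g : bdm f -> bdm g -> bdm (f \* g).
Proof.
move=> [mf [M HM]] [mg [K HK]]; split; first exact: measurable_funM.
by exists (M * K) => x x01; rewrite normrM ler_pM// ?HM ?HK.
Qed.

Lemma bdmD f g : bdm f -> bdm g -> bdm (f \+ g).
Proof.
move=> [mf [M HM]] [mg [K HK]]; split; first exact: measurable_funD.
by exists (M + K) => x x01; rewrite (le_trans (ler_normD _ _))// lerD ?HM ?HK.
Qed.

Lemma bdm_cst a : bdm (fun=> a).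
Proof. by split; [exact: measurable_cst|exists `|a|]. Qed.

Lemma bdmZ a f : bdm f -> bdm (fun x => a * f x).
Proof. by move=> bf; apply: (bdmM (fun=> a)) => //; exact: bdm_cst. Qed.

Lemma bdmN f : bdm f -> bdm (\- f).
Proof.
move=> bf; rewrite (_ : \- f = fun x => -1 * f x); first exact: bdmZ.
by apply/funext => x /=; rewrite mulN1r.
Qed.

Lemma bdmB f g : bdm f -> bdm g -> bdm (f \- g).
Proof. by move=> bf bg; apply: (bdmD f (\- g)) => //; exact: bdmN. Qed.

Lemma bdm_norm f : bdm f -> bdm (fun x => `|f x|).
Proof.
move=> [mf [M HM]]; split; first exact: measurableT_comp.
by exists M => x x01; rewrite normr_id HM.
Qed.

Lemma bdmX f : bdm f -> bdm (fun x => f x ^+ 2).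
Proof. by move=> bf; exact: (bdmM f f). Qed.

Lemma bdm_indic (B : set R) : measurable B -> bdm (\1_B).
Proof.
move=> mB; split; first exact: measurable_indic.
by exists 1 => x _; rewrite indicE; case: (_ \in _); rewrite ?normr1 ?normr0.
Qed.

Lemma bdm_expR a b : bdm (fun s => expR (a * (b - s))).
Proof.
split.
  apply: measurable_funTS; apply: measurableT_comp; first exact: measurable_expR.
  by apply: measurable_funM => //; exact: measurable_funB.
exists (expR (`|a| * (`|b| + 1))) => x /andP[x0 x1].
rewrite ger0_norm ?expR_ge0// ler_expR.
rewrite (le_trans (ler_norm _))// normrM ler_wpM2l//.
by rewrite (le_trans (ler_normB _ _))// lerD2l ger0_norm.
Qed.

Lemma bdm_integrable f a b : bdm f -> 0 <= a -> b <= 1 ->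
  mu.-integrable `[a, b] (EFin \o f).
Proof.
move=> [mf [M HM]] a0 b1.
have sub : `[a, b] `<=` (`[0, 1] : set R).
  by apply: subset_itv; rewrite bnd_simp.
have i01 : mu.-integrable (`[0, 1] : set R) (EFin \o f).
  apply: measurable_bounded_integrable => //.
    by rewrite /= lebesgue_measure_itv/= lte01 -EFinB ltry.
  exists M; split; first exact: num_real.
  by move=> K MK x /=; rewrite in_itv/= => x01; rewrite (le_trans (HM x x01))// ltW.
by apply: integrableS i01.
Qed.

Lemma iint_split f a b c : bdm f -> 0 <= a -> a <= b -> b <= c -> c <= 1 ->
  iint f a c = iint f a b + iint f b c.
Proof.
move=> bf a0 ab bc c1.
have H := @Rintegral_itvB R f (BLeft a) (BRight c) b.
have ig : mu.-integrable [set` Interval (BLeft a) (BRight c)] (EFin \o f).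
  exact: bdm_integrable.
have := H ig; rewrite !bnd_simp => /(_ ab bc).
rewrite Rintegral_itv_obnd_cbnd; last first.
  have : mu.-integrable `[b, c] (EFin \o f).
    by apply: bdm_integrable => //; exact: le_trans ab.
  by apply: integrableS => //; apply: subset_itvr; rewrite bnd_simp.
by rewrite /iint => <-; rewrite addrC subrK.
Qed.

Lemma iintD f g a b : bdm f -> bdm g -> 0 <= a -> b <= 1 ->
  iint (f \+ g) a b = iint f a b + iint g a b.
Proof. by move=> bf bg a0 b1; apply: RintegralD => //; exact: bdm_integrable. Qed.

Lemma iintB f g a b : bdm f -> bdm g -> 0 <= a -> b <= 1 ->
  iint (f \- g) a b = iint f a b - iint g a b.
Proof. by move=> bf bg a0 b1; apply: RintegralB => //; exact: bdm_integrable. Qed.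

Lemma iintZ r f a b : bdm f -> 0 <= a -> b <= 1 ->
  iint (fun x => r * f x) a b = r * iint f a b.
Proof. by move=> bf a0 b1; apply: RintegralZl => //; exact: bdm_integrable. Qed.

Lemma iint_cst r a b : a <= b -> iint (fun=> r) a b = r * (b - a).
Proof.
move=> ab; rewrite /iint Rintegral_cst//; congr (_ * _).
rewrite /= lebesgue_measure_itv/= lte_fin; case: ltP => [_|ba]; first by rewrite -EFinB.
by have -> : a = b by [apply/le_anti/andP]; rewrite subrr.
Qed.

(** Dropping the right end point, a null set, lets the comparison lemmas ask for bounds on [[a, b)]
    only. This matters at 1, where a path may jump and [osup] gives no control. *)
Lemma iint_co f a b : bdm f -> 0 <= a -> b <= 1 ->
  iint f a b = Rintegral mu `[a, b[ f.
Proof.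
move=> bf a0 b1; rewrite /iint Rintegral_itv_bndo_bndc//.
have : mu.-integrable `[a, b] (EFin \o f) by exact: bdm_integrable.
by apply: integrableS => //; apply: subset_itvl; rewrite bnd_simp.
Qed.

Lemma eq_iint f g a b : bdm f -> bdm g -> 0 <= a -> b <= 1 ->
  (forall x, a <= x < b -> f x = g x) -> iint f a b = iint g a b.
Proof.
move=> bf bg a0 b1 fg; rewrite !iint_co//; apply: eq_Rintegral => x.
by rewrite inE/= in_itv/= => /fg.
Qed.

Lemma le_iint f g a b : bdm f -> bdm g -> 0 <= a -> b <= 1 ->
  (forall x, a <= x < b -> f x <= g x) -> iint f a b <= iint g a b.
Proof.
move=> bf bg a0 b1 fg; rewrite !iint_co//; apply: le_Rintegral => //.
- have : mu.-integrable `[a, b] (EFin \o f) by exact: bdm_integrable.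
  by apply: integrableS => //; apply: subset_itvl; rewrite bnd_simp.
- have : mu.-integrable `[a, b] (EFin \o g) by exact: bdm_integrable.
  by apply: integrableS => //; apply: subset_itvl; rewrite bnd_simp.
Qed.

Lemma iint_norm_le f g a b : bdm f -> bdm g -> 0 <= a -> b <= 1 ->
  (forall x, a <= x < b -> `|f x| <= g x) -> `|iint f a b| <= iint g a b.
Proof.
move=> bf bg a0 b1 fg.
apply: (@le_trans _ _ (iint (fun x => `|f x|) a b)).
  by apply: le_normr_Rintegral => //; exact: bdm_integrable.
by apply: le_iint => //; exact: bdm_norm.
Qed.

Lemma iint_bound f K a b : bdm f -> 0 <= a -> a <= b -> b <= 1 ->
  (forall x, a <= x < b -> `|f x| <= K) -> `|iint f a b| <= K * (b - a).
Proof.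
move=> bf a0 ab b1 fK; rewrite -iint_cst//.
by apply: iint_norm_le => //; exact: bdm_cst.
Qed.

Lemma iint_ge0 f a b : (forall x, 0 <= f x) -> 0 <= iint f a b.
Proof. by move=> f0; apply: Rintegral_ge0. Qed.

Lemma iint_expR r c a b : a <= b ->
  r * iint (fun s => expR (- r * (c - s))) a b =
  expR (- r * (c - b)) - expR (- r * (c - a)).
Proof.
rewrite le_eqVlt => /predU1P[->|ab].
  by rewrite subrr /iint set_itv1 Rintegral_set1 mulr0.
have cE (k : R) : continuous (fun s : R => k * expR (- r * (c - s)) : R).
  by move=> x; apply/differentiable_continuous/derivable1_diffP; exact: ex_derive.
have cE1 : continuous (fun s : R => expR (- r * (c - s)) : R).
  by move=> x; apply/differentiable_continuous/derivable1_diffP; exact: ex_derive.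
rewrite -[LHS]/(r * fine (\int[mu]_(x in `[a, b]) (expR (- r * (c - x)))%:E)).
have i1 : mu.-integrable `[a, b] (EFin \o (fun s => expR (- r * (c - s)))).
  apply: continuous_compact_integrable; first exact: segment_compact.
  exact: continuous_subspaceT.
rewrite -[r * _]RintegralZl// /Rintegral.
rewrite (@continuous_FTC2 R _ (fun s => expR (- r * (c - s))))//.
- by apply: continuous_subspaceT; exact: cE.
- split.
  + by move=> z _; exact: ex_derive.
  + by apply/cvg_at_right_filter; exact: cE1.
  + by apply/cvg_at_left_filter; exact: cE1.
- move=> z _; rewrite derive1E derive_val /GRing.scale/=; ring.
Qed.

End UnitIntervalIntegral.

(** * The Ornstein-Uhlenbeck functional *)

Section OrnsteinUhlenbeck.
Context {R : realType}.
Implicit Types (f g : R -> R) (gam t M : R).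

(** The memory term of [OU], isolated because it is Lipschitz in time and continuous in [f] for the
    L1 distance, while evaluation of [f] is neither. *)
Definition expconv gam f t := iint (fun s => expR (- gam * (t - s)) * f s) 0 t.

Lemma OU_expconv gam f t : OU gam f t = f t - gam * expconv gam f t.
Proof. by []. Qed.

Lemma bdm_expf gam f t : bdm f -> bdm (fun s => expR (- gam * (t - s)) * f s).
Proof. by move=> bf; apply: bdmM => //; exact: bdm_expR. Qed.

Lemma expR_gam_bound gam t : `|t| <= 1 -> expR (- gam * t) <= expR `|gam|.
Proof.
move=> t1; rewrite ler_expR (le_trans (ler_norm _))// normrM normrN.
by rewrite -[leRHS]mulr1 ler_wpM2l.
Qed.

(** Both signs come from [1 + x <= expR x], at [x = - gam * t] and at [x = gam * t]; the latter
    becomes an upper bound because the two exponentials multiply to 1. *)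
Lemma expR_sub1_bound gam t : `|t| <= 1 ->
  `|expR (- gam * t) - 1| <= `|gam| * expR `|gam| * `|t|.
Proof.
move=> t1; have E0 := @expR_gt0 R (- gam * t).
have h1 := expR_ge1Dx (- gam * t).
have h2 := expR_ge1Dx (gam * t).
have hm : expR (- gam * t) * expR (gam * t) = 1.
  by rewrite -expRD mulNr addNr expR0.
have hb := expR_gam_bound gam t t1.
have E1 : 1 <= expR `|gam| by rewrite -expR0 ler_expR.
have ht : `|gam * t| = `|gam| * `|t| := normrM _ _.
have g0 := normr_ge0 gam; have t0 := normr_ge0 t.
have h3 := ler_norm (gam * t).
have h4 : - (gam * t) <= `|gam * t| by rewrite -normrN ler_norm.
have h5 : `|gam| * `|t| <= `|gam| * expR `|gam| * `|t|.
  by rewrite -mulrA ler_wpM2l// ler_peMl.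
have h6 : expR (- gam * t) * `|gam * t| <= `|gam| * expR `|gam| * `|t|.
  by rewrite ht mulrCA -mulrA ler_wpM2l// ler_wpM2r.
have h7 : expR (- gam * t) * (1 + gam * t) <= expR (- gam * t) * expR (gam * t).
  by rewrite ler_wpM2l// ltW.
rewrite hm in h7.
have h8 : expR (- gam * t) * - (gam * t) <= expR (- gam * t) * `|gam * t|.
  by rewrite ler_wpM2l// ltW.
have h9 : expR (- gam * t) - 1 <= expR (- gam * t) * - (gam * t).
  by move: h7; rewrite mulrDr mulr1 mulrN; lra.
rewrite ler_norml; apply/andP; split.
  by rewrite mulNr in h1 *; move: h5; rewrite -ht; lra.
exact: le_trans h9 (le_trans h8 h6).
Qed.

Lemma expconv_bound gam f M s t : bdm f -> 0 <= s -> s <= t -> t <= 1 ->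
  (forall x, s <= x < t -> `|f x| <= M) ->
  `|iint (fun u => expR (- gam * (t - u)) * f u) s t| <= expR `|gam| * M * (t - s).
Proof.
move=> bf s0 st t1 fM; apply: iint_bound => //; first exact: bdm_expf.
move=> x /andP[sx xt]; rewrite normrM ger0_norm ?expR_ge0//.
rewrite ler_pM ?expR_ge0 ?fM ?sx//; apply: expR_gam_bound.
by rewrite ger0_norm; lra.
Qed.

(** The flow property in time. It underlies the Lipschitz bound, the uniqueness argument in [OU_eq0]
    and the AR(1) recursion on the grid. *)
Lemma expconv_step gam f s t : bdm f -> 0 <= s -> s <= t -> t <= 1 ->
  expconv gam f t = expR (- gam * (t - s)) * expconv gam f s +
    iint (fun u => expR (- gam * (t - u)) * f u) s t.
Proof.
move=> bf s0 st t1; rewrite /expconv (@iint_split _ _ 0 s t)//; last exact: bdm_expf.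
congr (_ + _); rewrite -iintZ//; last 2 first.
- exact: bdm_expf.
- exact: le_trans t1.
congr (iint _ _ _); apply/funext => u; rewrite mulrA -expRD; congr (expR _ * _).
by ring.
Qed.

(** The first term comes from the exponential factor acting on the convolution up to [s], the second
    from the new piece on [[s, t]]. *)
Definition lipK gam : R := `|gam| * expR `|gam| * expR `|gam| + expR `|gam|.

Lemma lipK_ge0 gam : 0 <= lipK gam.
Proof. by rewrite /lipK addr_ge0 ?mulr_ge0 ?expR_ge0. Qed.

Lemma expconv_lip gam f M s t : bdm f -> 0 <= s -> s <= t -> t <= 1 ->
  (forall x, 0 <= x < 1 -> `|f x| <= M) ->
  `|expconv gam f t - expconv gam f s| <= lipK gam * M * (t - s).
Proof.
move=> bf s0 st t1 fM; rewrite (expconv_step gam f s t)//.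
have M0 : 0 <= M by rewrite (le_trans _ (fM 0 _))// lexx ltr01.
set J := expconv gam f s.
have HJ : `|J| <= expR `|gam| * M * 1.
  have : `|J| <= expR `|gam| * M * (s - 0).
    apply: expconv_bound => //; first exact: le_trans t1.
    by move=> x /andP[x0 xs]; rewrite fM// x0; lra.
  move=> /le_trans; apply; rewrite ler_wpM2l ?mulr_ge0 ?expR_ge0//; lra.
have H2 : `|iint (fun u => expR (- gam * (t - u)) * f u) s t| <=
    expR `|gam| * M * (t - s).
  by apply: expconv_bound => // x /andP[xs xt]; rewrite fM//; lra.
have ts : `|t - s| = t - s by rewrite ger0_norm; lra.
have ts1 : `|t - s| <= 1 by rewrite ts; lra.
have H3 := expR_sub1_bound gam (t - s) ts1.
rewrite ts in H3.
have H4 : `|(expR (- gam * (t - s)) - 1) * J| <=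
    `|gam| * expR `|gam| * (t - s) * (expR `|gam| * M * 1).
  by rewrite normrM ler_pM.
rewrite (_ : _ * J + _ - J = (expR (- gam * (t - s)) - 1) * J +
   iint (fun u => expR (- gam * (t - u)) * f u) s t); last by ring.
by rewrite (le_trans (ler_normD _ _))// /lipK; lra.
Qed.

Lemma expconv0 gam f : expconv gam f 0 = 0.
Proof. by rewrite /expconv /iint set_itv1 Rintegral_set1. Qed.

Lemma expconv_bound01 gam f M t : bdm f -> 0 <= t <= 1 ->
  (forall x, 0 <= x < 1 -> `|f x| <= M) -> `|expconv gam f t| <= expR `|gam| * M.
Proof.
move=> bf /andP[t0 t1] fM.
have M0 : 0 <= M by rewrite (le_trans _ (fM 0 _))// lexx ltr01.
have : `|expconv gam f t| <= expR `|gam| * M * (t - 0).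
  apply: expconv_bound => //.
  by move=> x /andP[x0 xs]; rewrite fM// x0; lra.
move=> /le_trans; apply; rewrite ler_piMr ?mulr_ge0 ?expR_ge0//; lra.
Qed.

(** [OU gam f] differs from [f] by a function that is Lipschitz on [[0, 1]]. *)
Lemma OU_cadlag gam f : cadlag f -> cadlag (OU gam f).
Proof.
move=> cf; have bf := cadlag_bdm f cf.
have [M M0 fM] := cadlag_bounded f cf.
have fM' x : 0 <= x < 1 -> `|f x| <= M.
  by move=> /andP[x0 x1]; rewrite fM// x0 ltW.
have L0 : 0 < lipK gam * M + 1.
  by rewrite ltr_wpDl// mulr_ge0 ?lipK_ge0// ltW.
have lip s t : 0 <= s -> s <= t -> t <= 1 ->
    `|expconv gam f t - expconv gam f s| <= (lipK gam * M + 1) * (t - s).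
  move=> s0 st t1; rewrite (le_trans (@expconv_lip _ _ M _ _ bf s0 st t1 fM'))//.
  by rewrite ler_wpM2r//; lra.
case: cf => rc ll; split=> t t0 t1.
  rewrite /OU; apply: cvgB; first exact: rc.
  apply: cvgMr; rewrite -/(expconv gam f _).
  apply/cvgrPdist_le => e e0; near=> x.
  have tx : t < x by near: x; exact: nbhs_right_gt.
  have x1 : x <= 1 by near: x; exact: nbhs_right_le.
  rewrite distrC; apply: (le_trans (lip _ _ t0 (ltW tx) x1)).
  rewrite -ler_pdivlMl// lerBlDr.
  by near: x; apply: nbhs_right_le; rewrite ltrDr mulr_gt0// invr_gt0.
have /cvg_ex[l hl] := ll t t0 t1.
apply/cvg_ex; exists (l - gam * expconv gam f t).
apply: cvgB => //; apply: cvgMr.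
apply/cvgrPdist_le => e e0; near=> x.
have tx : x < t by near: x; exact: nbhs_left_lt.
have x1 : 0 <= x by near: x; exact: nbhs_left_ge.
apply: (le_trans (lip _ _ x1 (ltW tx) t1)).
rewrite -ler_pdivlMl// lerBlDr -lerBlDl.
by near: x; apply: nbhs_left_ge; rewrite ltrBlDl ltrDr mulr_gt0// invr_gt0.
Unshelve. all: by end_near. Qed.

Lemma OU_bound gam f M t : bdm f -> 0 <= t <= 1 ->
  (forall x, 0 <= x < 1 -> `|f x| <= M) -> `|f t| <= M ->
  `|OU gam f t| <= (1 + `|gam| * expR `|gam|) * M.
Proof.
move=> bf t01 fM ftM; rewrite OU_expconv (le_trans (ler_normB _ _))//.
rewrite mulrDl mul1r lerD// normrM -mulrA ler_wpM2l//.
exact: expconv_bound01.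
Qed.

Lemma expconvB gam f g t : bdm f -> bdm g -> 0 <= t <= 1 ->
  `|expconv gam f t - expconv gam g t| <=
    expR `|gam| * iint (fun s => `|f s - g s|) 0 1.
Proof.
move=> bf bg /andP[t0 t1].
have bd : bdm (fun s => `|f s - g s|) by exact: (bdm_norm (f \- g) (bdmB _ _ bf bg)).
rewrite /expconv -iintB//; try exact: bdm_expf.
apply: (@le_trans _ _ (iint (fun s => expR `|gam| * `|f s - g s|) 0 t)).
  apply: iint_norm_le => //; [by apply: bdmB; exact: bdm_expf|exact: bdmZ|].
  move=> x /andP[x0 xt] /=; rewrite -mulrBr normrM ler_wpM2r// ger0_norm ?expR_ge0//.
  by apply: expR_gam_bound; rewrite ger0_norm; lra.
rewrite iintZ// ler_wpM2l ?expR_ge0//.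
rewrite [leRHS](@iint_split _ _ 0 t 1)// lerDl.
by apply: iint_ge0.
Qed.

Lemma sq_int_le f M : bdm f -> 0 <= M -> (forall x, 0 <= x < 1 -> `|f x| <= M) ->
  sq_int f <= M ^+ 2.
Proof.
move=> bf M0 fM.
have : `|iint (fun s => f s ^+ 2) 0 1| <= M ^+ 2 * (1 - 0).
  apply: iint_bound => //; first exact: bdmX.
  by move=> x x01; rewrite normrX lerXn2r ?nnegrE// fM.
by rewrite subr0 mulr1; apply: le_trans; exact: ler_norm.
Qed.

Lemma sq_int_ge0 f : 0 <= sq_int f.
Proof. by apply: iint_ge0 => x; exact: sqr_ge0. Qed.

Lemma sq_intB f g M : bdm f -> bdm g ->
  (forall x, 0 <= x < 1 -> `|f x| <= M) -> (forall x, 0 <= x < 1 -> `|g x| <= M) ->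
  `|sq_int f - sq_int g| <= 2 * M * iint (fun s => `|f s - g s|) 0 1.
Proof.
move=> bf bg fM gM.
have bd : bdm (fun s => `|f s - g s|) by exact: (bdm_norm (f \- g) (bdmB _ _ bf bg)).
rewrite -[sq_int f]/(iint (fun s => f s ^+ 2) 0 1).
rewrite -[sq_int g]/(iint (fun s => g s ^+ 2) 0 1).
rewrite -iintB//; try exact: bdmX.
rewrite -iintZ//; apply: iint_norm_le => //.
- by apply: bdmB; exact: bdmX.
- exact: bdmZ.
move=> x x01 /=; rewrite subr_sqr normrM mulrC ler_wpM2r//.
rewrite (le_trans (ler_normD _ _))// mulr2n mulrDl mul1r lerD ?fM ?gM//.
Qed.

(* Gronwall: on consecutive blocks of length tau ~ 1/(2|gam|) the bound on |f| is
   halved again and again. *)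
Lemma OU_eq0 gam f : cadlag f -> (forall t, 0 <= t < 1 -> OU gam f t = 0) ->
  forall t, 0 <= t < 1 -> f t = 0.
Proof.
move=> cf of0; have bf := cadlag_bdm f cf.
have [M M0 fM] := cadlag_bounded f cf.
have fE t : 0 <= t < 1 -> f t = gam * expconv gam f t.
  by move=> /of0/eqP; rewrite OU_expconv subr_eq0 => /eqP.
pose c := `|gam| * expR `|gam| + 1.
have c0 : 0 < c by rewrite ltr_wpDl// mulr_ge0 ?expR_ge0.
pose tau := (2 * c)^-1.
have tau0 : 0 < tau by rewrite invr_gt0 mulr_gt0.
have ctau : c * tau = 2^-1 by rewrite /tau invfM mulrCA divff ?mulr1// gt_eqF.
suff main k : forall t, 0 <= t < 1 -> t < k%:R * tau -> f t = 0.
  move=> t t01; apply: (main (Num.truncn (t / tau)).+1) => //.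
  by rewrite -ltr_pdivrMr// truncnS_gt.
elim: k => [|k IH] t t01 tk.
  by move: tk; rewrite mul0r; case/andP: t01; lra.
have [tk'|kt] := ltP t (k%:R * tau); first exact: IH.
have k0 : 0 <= k%:R * tau by rewrite mulr_ge0// ltW.
have rec j : forall s, 0 <= s < 1 -> s < k.+1%:R * tau -> `|f s| <= M * 2^-1 ^+ j.
  elim: j => [|j IHj] s s01 sk.
    by rewrite expr0 mulr1 fM//; case/andP: s01 => -> /ltW.
  have [sk'|ks] := ltP s (k%:R * tau).
    by rewrite IH// normr0 mulr_ge0 ?exprn_ge0 ?ltW.
  case/andP: (s01) => s0 s1.
  have kt1 : k%:R * tau <= 1 by lra.
  rewrite fE// normrM (expconv_step gam f (k%:R * tau))//; last exact: ltW.
  rewrite [X in _ * X + _](_ : _ = 0); last first.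
    apply/eqP; rewrite -normr_le0.
    have : `|expconv gam f (k%:R * tau)| <= expR `|gam| * 0 * (k%:R * tau - 0).
      apply: expconv_bound => // x /andP[x0 xk]; rewrite IH ?normr0//.
      by rewrite x0; lra.
    by rewrite mulr0 mul0r.
  rewrite mulr0 add0r.
  have H : `|iint (fun u => expR (- gam * (s - u)) * f u) (k%:R * tau) s| <=
      expR `|gam| * (M * 2^-1 ^+ j) * (s - k%:R * tau).
    apply: expconv_bound => //; first exact: ltW.
    by move=> x /andP[kx xs]; rewrite IHj//; [apply/andP; split|]; lra.
  have st : s - k%:R * tau <= tau.
    by move: sk; rewrite -natr1 mulrDl mul1r; lra.
  have E0 := expR_ge0 `|gam|.
  have g0 := normr_ge0 gam.
  apply: (@le_trans _ _ (`|gam| * (expR `|gam| * (M * 2^-1 ^+ j) * (s - k%:R * tau)))).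
    by rewrite ler_wpM2l.
  have X0 : 0 <= M * 2^-1 ^+ j by rewrite mulr_ge0 ?exprn_ge0 ?ltW.
  rewrite exprSr [X in _ <= X]mulrA -[X in _ <= _ * X]ctau.
  rewrite (_ : `|gam| * _ = (M * 2^-1 ^+ j) * (`|gam| * expR `|gam| * (s - k%:R * tau)));
    last by ring.
  rewrite ler_wpM2l// ler_pM ?mulr_ge0//; first by lra.
  by rewrite /c lerDl.
apply/eqP; rewrite -normr_le0; apply/ler_addgt0Pr => e e0; rewrite add0r.
have : \forall j \near \oo, 2^-1 ^+ j <= e / M :> R.
  have : (2^-1 : R) ^+ j @[j --> \oo] --> (0 : R).
    by apply: cvg_expr; rewrite ger0_norm// invf_lt1// ltr1n.
  move=> /cvgrPdist_le/(_ (e / M)); rewrite divr_gt0// => /(_ isT).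
  apply: filterS => j; rewrite sub0r normrN ger0_norm//.
move=> [j _ /(_ j (leqnn _)) Hj].
by rewrite (le_trans (rec j t t01 tk))// mulrC -ler_pdivlMr.
Qed.

(** A nonzero value at [t < 1] persists to the right of [t] and makes the integral positive. At 1
    there is no such neighbourhood, so the conclusion stops short of it. *)
Lemma sq_int_eq0 f : cadlag f -> sq_int f = 0 -> forall t, 0 <= t < 1 -> f t = 0.
Proof.
move=> cf f0 t /andP[t0 t1]; apply/eqP; rewrite -normr_le0 leNgt; apply/negP => ft.
have ft2 : 0 < `|f t| / 2 by rewrite divr_gt0.
have [del del0 H] := cadlag_right f t _ cf t0 t1 ft2.
have bf := bdmX f (cadlag_bdm f cf).
pose b := Num.min 1 (t + del).
have tb : t < b by rewrite lt_min t1/= ltrDl.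
have b1 : b <= 1 by rewrite ge_min lexx.
have bd : b <= t + del by rewrite ge_min lexx orbT.
have : (`|f t| / 2) ^+ 2 * (b - t) <= 0.
  rewrite -f0 -[sq_int f]/(iint (fun s => f s ^+ 2) 0 1).
  rewrite (@iint_split _ _ 0 t 1)// ?(ltW t1)// (@iint_split _ _ t b 1)// ?(ltW tb)//.
  apply: (@le_trans _ _ (iint (fun s => f s ^+ 2) t b)); last first.
    have p1 : 0 <= iint (fun s => f s ^+ 2) 0 t by apply: iint_ge0 => ?; exact: sqr_ge0.
    have p2 : 0 <= iint (fun s => f s ^+ 2) b 1 by apply: iint_ge0 => ?; exact: sqr_ge0.
    by lra.
  rewrite -iint_cst; last exact: ltW.
  apply: le_iint => //; first exact: bdm_cst.
  move=> x /andP[tx xb]; rewrite -[leRHS]real_normK ?num_real//.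
  rewrite lerXn2r ?nnegrE ?divr_ge0//.
  have Hx : `|f t - f x| <= `|f t| / 2 by apply: H; rewrite tx/=; lra.
  have : `|f t| - `|f x| <= `|f t - f x| by exact: lerB_dist.
  by lra.
by apply/negP; rewrite -ltNge mulr_gt0 ?exprn_gt0// subr_gt0.
Qed.

End OrnsteinUhlenbeck.

(** * Skorokhod-continuous functionals *)

Section SkorokhodContinuity.
Context {R : realType}.
Implicit Types (f g l : R -> R) (gam e : R) (F G : (R -> R) -> R).
Notation mu := (@lebesgue_measure R).

Lemma time_change01 l t : time_change l -> 0 <= t <= 1 -> 0 <= l t <= 1.
Proof.
move=> [_ [inc [l0 l1]]] /andP[]; rewrite le_eqVlt => /predU1P[<- _|t0].
  by rewrite l0 lexx ler01.
rewrite le_eqVlt => /predU1P[->|t1]; first by rewrite l1 lexx ler01.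
apply/andP; split; [rewrite -l0|rewrite -l1]; apply/ltW/inc => //; exact: ltW.
Qed.

Lemma time_change_lt1 l t : time_change l -> 0 <= t < 1 -> 0 <= l t < 1.
Proof.
move=> tl /andP[t0 t1]; have /andP[-> _] : 0 <= l t <= 1.
  by apply: time_change01 => //; rewrite t0 ltW.
by case: tl => _ [inc [_ l1]]; rewrite -[X in _ < X]l1/=; exact: inc.
Qed.

Lemma time_change_surj l u : time_change l -> 0 <= u <= 1 ->
  exists2 t, 0 <= t <= 1 & l t = u.
Proof.
move=> [cl [inc [l0 l1]]] u01.
have [|t] := @IVT _ l 0 1 u ler01 cl.
  by rewrite l0 l1 min_l// max_r.
by rewrite in_itv/= => ? <-; exists t.
Qed.

(** The infimum yields one good time change; its suprema give pointwise bounds only after the sets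
    are shown bounded, since [sup] has a default value on unbounded sets. For the second supremum
    this is where [cadlag] enters. *)
Lemma skorokhod_dist_lt f g e : cadlag f -> cadlag g -> skorokhod_dist f g < e ->
  exists l, [/\ time_change l, forall t, 0 <= t <= 1 -> `|l t - t| < e &
    forall t, 0 <= t <= 1 -> `|f t - g (l t)| < e].
Proof.
move=> cf cg; rewrite /skorokhod_dist; set S := [set _ | _ in _] => Se.
have idS : time_change (id : R -> R).
  split; first by apply: continuous_subspaceT => x; exact: cvg_id.
  by split.
have hS : has_inf S.
  split; first by apply: image_nonempty; exists id.
  exists 0 => _ [l tl <-]; rewrite le_max; apply/orP; left.
  have l0 : l 0 = 0 by case: (tl) => _ [_ []].
  apply: ub_le_sup; last first.
    by exists 0 => /=; rewrite ?in_itv/= ?lexx ?ler01// l0 subrr normr0.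
  exists 2 => _ [t /= + <-]; rewrite in_itv/= => t01.
  have /andP[? ?] := time_change01 l t tl t01; case/andP: t01 => ? ?.
  by rewrite ler_norml; apply/andP; split; lra.
have eS : 0 < e - inf S by rewrite subr_gt0.
have [_ [l tl <-]] := inf_adherent eS hS.
rewrite addrC subrK gt_max => /andP[H1 H2]; exists l; split=> // t t01.
  apply: le_lt_trans H1; apply: ub_le_sup; last by exists t => //=; rewrite in_itv.
  exists 2 => _ [s /= + <-]; rewrite in_itv/= => s01.
  have /andP[? ?] := time_change01 l s tl s01; case/andP: s01 => ? ?.
  by rewrite ler_norml; apply/andP; split; lra.
apply: le_lt_trans H2; apply: ub_le_sup; last by exists t => //=; rewrite in_itv.
have [M _ HM] := cadlag_bounded f cf.
have [K _ HK] := cadlag_bounded g cg.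
exists (M + K) => _ [s /= + <-]; rewrite in_itv/= => s01.
rewrite (le_trans (ler_normB _ _))// lerD ?HM// HK//.
exact: time_change01.
Qed.

Lemma skorokhod_dist_le f g e :
  (forall t, 0 <= t <= 1 -> `|f t - g t| <= e) -> skorokhod_dist f g <= e.
Proof.
move=> fg; have e0 : 0 <= e by rewrite (le_trans _ (fg 0 _))// lexx ler01.
have idS : time_change (id : R -> R).
  split; first by apply: continuous_subspaceT => x; exact: cvg_id.
  by split.
have ne0 (h : R -> R) : [set h t | t in `[0%R : R, 1%R]] !=set0.
  by exists (h 0), 0 => //=; rewrite in_itv/= lexx ler01.
apply: (@le_trans _ _ (Num.max (sup [set `|id t - t| | t in `[0%R : R, 1%R]])
                   (sup [set `|f t - g (id t)| | t in `[0%R : R, 1%R]]))).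
  apply: ge_inf; last by exists id.
  exists 0 => _ [l tl <-]; rewrite le_max; apply/orP; left.
  have l0 : l 0 = 0 by case: (tl) => _ [_ []].
  apply: ub_le_sup; last first.
    by exists 0 => /=; rewrite ?in_itv/= ?lexx ?ler01// l0 subrr normr0.
  exists 2 => _ [t /= + <-]; rewrite in_itv/= => t01.
  have /andP[? ?] := time_change01 l t tl t01; case/andP: t01 => ? ?.
  by rewrite ler_norml; apply/andP; split; lra.
rewrite ge_max; apply/andP; split.
  by apply: ge_sup => // _ [t /= _ <-]; rewrite subrr normr0.
by apply: ge_sup => // _ [t /= + <-]; rewrite in_itv/=; exact: fg.
Qed.

(** The end point is left out on purpose: time changes map [[0, 1)] onto itself, so this supremum
    ignores a jump at time 1 and is still Skorokhod-continuous. *)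
Definition osup f := sup [set `|f t| | t in `[0%R : R, 1%R[].

Lemma osup_le f M : (forall t, 0 <= t < 1 -> `|f t| <= M) -> osup f <= M.
Proof.
move=> fM; apply: ge_sup; last by move=> _ [t /= + <-]; rewrite in_itv/=; exact: fM.
by exists `|f 0|, 0 => //=; rewrite in_itv/= lexx ltr01.
Qed.

Lemma le_osup f t : cadlag f -> 0 <= t < 1 -> `|f t| <= osup f.
Proof.
move=> cf t01; have [M _ HM] := cadlag_bounded f cf.
apply: ub_le_sup; last by exists t => //=; rewrite in_itv/=.
exists M => _ [s /= + <-]; rewrite in_itv/= => /andP[s0 s1].
by rewrite HM// s0 ltW.
Qed.

Lemma iint_indic_le (B : set R) e : measurable B -> (mu B <= e%:E)%E ->
  iint \1_B 0 1 <= e.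
Proof.
move=> mB Be; rewrite /iint /Rintegral integral_indic//.
have H : (mu (B `&` `[0%R, 1%R]) <= e%:E)%E.
  apply: le_trans Be; apply: le_measure; rewrite ?inE//.
  exact: measurableI.
rewrite -lee_fin fineK// ge0_fin_numE//; exact: le_lt_trans H (ltry _).
Qed.

(* A Skorokhod-close g is f up to a small time shift, which is harmless outside
   the exceptional set of fin_osc_bad_set. *)
Lemma skorokhod_close f e : cadlag f -> 0 < e -> exists2 del, 0 < del &
  forall g, cadlag g -> skorokhod_dist f g < del ->
  [/\ iint (fun s => `|f s - g s|) 0 1 < e, `|f 1 - g 1| < e & `|osup f - osup g| < e].
Proof.
move=> cf e0; have [M M0 HM] := cadlag_bounded f cf.
have e4 : 0 < e / 4 by lra.
have K0 : 0 < 2 * M + 1 by lra.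
(* On the exceptional set the integrand is at most [2 * M + 1]: [2 * M] from two values of [f], 1
   from the distance after the time change. Its integral there is then at most [e / 4]. *)
have eta0 : 0 < e / 4 / (2 * M + 1) by rewrite divr_gt0.
have [d1 [B [d10 mB Be HB]]] := fin_osc_bad_set _ _ _ _ _ (cadlag_fin_osc f _ cf e4) eta0.
exists (Num.min (Num.min d1 (e / 4)) 1); first by rewrite !lt_min d10 e4 ltr01.
move=> g cg /(skorokhod_dist_lt _ _ _ cf cg)[l [tl Hl Hf]].
have Hl' t : 0 <= t <= 1 -> `|l t - t| < d1.
  by move=> /Hl; rewrite !lt_min => /andP[/andP[]].
have Hf4 t : 0 <= t <= 1 -> `|f t - g (l t)| < e / 4.
  by move=> /Hf; rewrite !lt_min => /andP[/andP[]].
have Hf1 t : 0 <= t <= 1 -> `|f t - g (l t)| < 1.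
  by move=> /Hf; rewrite !lt_min => /andP[/andP[]].
have l1 : l 1 = 1 by case: tl => _ [_ []].
have bd : bdm (fun s => `|f s - g s|).
  exact: (bdm_norm (f \- g) (bdmB _ _ (cadlag_bdm f cf) (cadlag_bdm g cg))).
(* Each [u] is written as [l t], so that [f u - g u] passes through [f t]: close to [g u] by the
   choice of [l], close to [f u] by the small shift. *)
have surj u : 0 <= u < 1 -> exists2 t, 0 <= t < 1 & l t = u.
  move=> /andP[u0 u1]; have [|t /andP[t0]] := time_change_surj l u tl.
    by rewrite u0 ltW.
  rewrite le_eqVlt => /predU1P[->|t1] tu; last by exists t; rewrite ?t0.
  by move: u1; rewrite -tu l1 ltxx.
split.
- apply: (@le_lt_trans _ _ (iint (fun s => e / 2 + (2 * M + 1) * \1_B s) 0 1)).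
    apply: le_iint => //.
      by apply: bdmD; [exact: bdm_cst|apply: bdmZ; exact: bdm_indic].
    move=> u u01; have [t t01 lt] := surj u u01.
    have t01' : 0 <= t <= 1 by case/andP: t01 => -> /ltW.
    have u01' : 0 <= u <= 1 by case/andP: u01 => -> /ltW.
    have h4 := Hf4 t t01'; have hd := Hl' t t01'; have h1 := Hf1 t t01'.
    rewrite lt in h4 hd h1.
    have tri : `|f u - g u| <= `|f u - f t| + `|f t - g u| by exact: ler_distD.
    rewrite indicE; have [uB|uB] := boolP (u \in B).
      have fu := HM u u01'; have ft := HM t t01'.
      have := ler_normB (f u) (f t); rewrite mulr1; lra.
    rewrite mulr0 addr0.
    have : `|f t - f u| <= e / 4.
      by apply: HB => //; [move=> Bu; move/negP: uB; apply; rewrite inE|rewrite distrC].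
    by rewrite distrC; lra.
  rewrite (@iintD _ (fun=> e / 2) (fun s => (2 * M + 1) * \1_B s))//; last 2 first.
  - exact: bdm_cst.
  - by apply: bdmZ; exact: bdm_indic.
  rewrite iint_cst// iintZ//; last exact: bdm_indic.
  have := iint_indic_le B _ mB Be.
  rewrite ler_pdivlMr// mulrC; lra.
- by have := Hf4 1; rewrite l1 => /(_ _)/lt_trans; apply; rewrite ?ler01 ?lexx//; lra.
- apply: (@le_lt_trans _ _ (e / 4)); last lra.
  have h1 : osup f <= osup g + e / 4.
    apply: osup_le => t t01.
    have t01' : 0 <= t <= 1 by case/andP: t01 => -> /ltW.
    have := le_osup g _ cg (time_change_lt1 l t tl t01).
    by have := Hf4 t t01'; have := lerB_dist (f t) (g (l t)); lra.
  have h2 : osup g <= osup f + e / 4.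
    apply: osup_le => t t01; have [s s01 ls] := surj t t01.
    have s01' : 0 <= s <= 1 by case/andP: s01 => -> /ltW.
    have := le_osup f _ cf s01; have := Hf4 s s01'; rewrite ls.
    by have := lerB_dist (g t) (f s); rewrite (distrC (g t)); lra.
  by rewrite ler_distl; apply/andP; split; lra.
Qed.

Lemma skc_osup : skorokhod_continuous osup.
Proof.
move=> f cf e e0; have [del del0 H] := skorokhod_close f e cf e0.
by exists del => // g cg /(H g cg)[].
Qed.

Lemma skc_eval1 : skorokhod_continuous (fun f => f 1).
Proof.
move=> f cf e e0; have [del del0 H] := skorokhod_close f e cf e0.
by exists del => // g cg /(H g cg)[].
Qed.

Lemma bdm_dist f g : cadlag f -> cadlag g -> bdm (fun s => `|f s - g s|).
Proof.
move=> cf cg.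
exact: (bdm_norm (f \- g) (bdmB _ _ (cadlag_bdm f cf) (cadlag_bdm g cg))).
Qed.

Lemma skc_OU1 gam : skorokhod_continuous (fun f => OU gam f 1).
Proof.
move=> f cf e e0.
have c0 : 0 < 1 + `|gam| * expR `|gam| by rewrite ltr_pwDl// mulr_ge0 ?expR_ge0.
have e'0 : 0 < e / (1 + `|gam| * expR `|gam|) by rewrite divr_gt0.
have [del del0 H] := skorokhod_close f _ cf e'0.
exists del => // g cg /(H g cg)[H1 H2 _]; rewrite !OU_expconv.
have H3 := expconvB gam f g 1 (cadlag_bdm f cf) (cadlag_bdm g cg).
rewrite ler01 lexx in H3; have {}H3 := H3 isT.
rewrite (_ : _ - _ = (f 1 - g 1) - gam * (expconv gam f 1 - expconv gam g 1)); last ring.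
rewrite (le_lt_trans (ler_normB _ _))// normrM.
have H4 : `|gam| * `|expconv gam f 1 - expconv gam g 1| <=
    `|gam| * expR `|gam| * iint (fun s => `|f s - g s|) 0 1.
  by rewrite -mulrA ler_wpM2l.
have H5 : `|gam| * expR `|gam| * iint (fun s => `|f s - g s|) 0 1 <=
    `|gam| * expR `|gam| * (e / (1 + `|gam| * expR `|gam|)).
  by rewrite ler_wpM2l ?mulr_ge0 ?expR_ge0// ltW.
have : (1 + `|gam| * expR `|gam|) * (e / (1 + `|gam| * expR `|gam|)) = e.
  by rewrite mulrC divfK// gt_eqF.
by rewrite mulrDl mul1r; lra.
Qed.

(** Squaring needs a uniform bound besides L1-closeness; closeness of [osup] provides it, bounding
    every nearby [g] by [M + 1] on [[0, 1)]. *)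
Lemma skc_sq_int_OU gam : skorokhod_continuous (fun f => sq_int (OU gam f)).
Proof.
move=> f cf e e0; set c := 1 + `|gam| * expR `|gam|.
have c0 : 0 < c by rewrite ltr_pwDl// mulr_ge0 ?expR_ge0.
have [M M0 HM] := cadlag_bounded f cf.
have M1 : osup f <= M.
  by apply: osup_le => t /andP[t0 t1]; rewrite HM// t0 ltW.
pose K := 2 * (c * (M + 1)) * c.
have K0 : 0 < K by rewrite !mulr_gt0//; lra.
have e'0 : 0 < Num.min 1 (e / K) by rewrite lt_min ltr01 divr_gt0.
have [del del0 H] := skorokhod_close f _ cf e'0.
exists del => // g cg /(H g cg)[H1 _ H3].
have bf := cadlag_bdm f cf; have bg := cadlag_bdm g cg.
have fM t : 0 <= t < 1 -> `|f t| <= M + 1.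
  by move=> /(le_osup f t cf); lra.
have gM t : 0 <= t < 1 -> `|g t| <= M + 1.
  move=> /(le_osup g t cg) /le_trans; apply.
  by move: H3; rewrite lt_min ltr_distlC => /andP[/andP[]]; lra.
have OUb h t : bdm h -> (forall t, 0 <= t < 1 -> `|h t| <= M + 1) ->
    0 <= t < 1 -> `|OU gam h t| <= c * (M + 1).
  move=> bh hM t01; apply: OU_bound => //; last exact: hM.
  by case/andP: t01 => -> /ltW.
have bOf := cadlag_bdm _ (OU_cadlag gam f cf).
have bOg := cadlag_bdm _ (OU_cadlag gam g cg).
apply: (le_lt_trans (sq_intB _ _ (c * (M + 1)) bOf bOg _ _)).
- by move=> t; exact: OUb.
- by move=> t; exact: OUb.
set I := iint (fun s => `|f s - g s|) 0 1.
have HI : iint (fun s => `|OU gam f s - OU gam g s|) 0 1 <= c * I.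
  apply: (@le_trans _ _ (iint (fun s => `|f s - g s| + `|gam| * expR `|gam| * I) 0 1)).
    apply: le_iint => //; first exact: bdm_dist (OU_cadlag gam f cf) (OU_cadlag gam g cg).
      by apply: bdmD; [exact: bdm_dist|exact: bdm_cst].
    move=> t /andP[t0 t1]; rewrite !OU_expconv.
    rewrite (_ : _ - _ = (f t - g t) - gam * (expconv gam f t - expconv gam g t));
      last ring.
    rewrite (le_trans (ler_normB _ _))// lerD2l normrM -mulrA ler_wpM2l//.
    by apply: expconvB => //; rewrite t0 ltW.
  rewrite (@iintD _ (fun s => `|f s - g s|) (fun=> `|gam| * expR `|gam| * I))//.
  - by rewrite iint_cst// subr0 mulr1 mulrDl mul1r.
  - exact: bdm_dist.
  - exact: bdm_cst.
have IK : K * I < e.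
  by move: H1; rewrite lt_min => /andP[_]; rewrite ltr_pdivlMr// mulrC.
apply: le_lt_trans IK.
rewrite (_ : K * I = 2 * (c * (M + 1)) * (c * I)); last by rewrite /K !mulrA.
rewrite ler_wpM2l//.
by rewrite mulr_ge0// mulr_ge0//; lra.
Qed.

Lemma skc_comp F (h : R -> R) : continuous h -> skorokhod_continuous F ->
  skorokhod_continuous (h \o F).
Proof.
move=> ch cF f cf e e0.
have /cvgrPdist_lt/(_ e e0)[r /= r0 Hr] := ch (F f).
by have [del del0 H] := cF f cf r r0; exists del => // g cg /(H g cg) /Hr.
Qed.

Lemma skc_comp2 F G (h : R * R -> R) : continuous h ->
  skorokhod_continuous F -> skorokhod_continuous G ->
  skorokhod_continuous (fun f => h (F f, G f)).
Proof.
move=> ch cF cG f cf e e0.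
have /cvgrPdist_lt/(_ e e0) := ch (F f, G f).
move=> /nbhs_ballP[r /= r0 Hr].
have [d1 d10 H1] := cF f cf r r0; have [d2 d20 H2] := cG f cf r r0.
exists (Num.min d1 d2); first by rewrite lt_min d10.
move=> g cg; rewrite lt_min => /andP[/(H1 g cg) K1 /(H2 g cg) K2].
by apply: Hr; split.
Qed.

(** The identity time change shows that uniformly close paths are Skorokhod-close. *)
Lemma skc_uniform F f e : skorokhod_continuous F -> cadlag f -> 0 < e ->
  exists2 del, 0 < del & forall g, cadlag g ->
    (forall t, 0 <= t <= 1 -> `|f t - g t| < del) -> `|F f - F g| < e.
Proof.
move=> cF cf e0; have [del del0 H] := cF f cf e e0.
exists (del / 2) => [|g cg fg]; first lra.
apply: H => //; apply: (@le_lt_trans _ _ (del / 2)); last lra.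
by apply: skorokhod_dist_le => t /fg /ltW.
Qed.

Lemma skc_open_gt F a : skorokhod_continuous F -> skorokhod_open [set f | a < F f].
Proof.
move=> cF f cf /= aF; have e0 : 0 < F f - a by rewrite subr_gt0.
have [del del0 H] := cF f cf _ e0; exists del => // g cg /(H g cg).
by rewrite ltr_distlC => /andP[]; lra.
Qed.

Lemma skc_measurable d (T : measurableType d) (Z : T -> R -> R) F :
  D_random_variable Z -> skorokhod_continuous F ->
  measurable_fun setT (fun w => F (Z w)).
Proof.
move=> [cZ mZ] cF; apply: (@measurability _ _ _ _ _ _ _ (RGenOInfty.measurableE R)).
move=> _ [_ [a ->] <-]; rewrite setTI.
rewrite (_ : _ @^-1` _ = Z @^-1` [set f | a < F f]); last first.
  by apply/seteqP; split => w /=; rewrite in_itv/= andbT.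
by apply: mZ; apply: sub_sigma_algebra; exact: skc_open_gt.
Qed.

Lemma open_nonzero : skorokhod_open [set f : R -> R | exists2 t, 0 <= t <= 1 & f t <> 0].
Proof.
move=> f cf [t t01 /eqP ft]; exists `|f t|; first by rewrite normr_gt0.
move=> g cg /(skorokhod_dist_lt _ _ _ cf cg)[l [tl _ Hf]].
exists (l t); first exact: time_change01.
by move=> g0; have := Hf t t01; rewrite g0 subr0 ltxx.
Qed.

(** Being nonzero somewhere on [[0, 1]] survives small Skorokhod perturbations, so the event of (D2)
    is the preimage of the complement of an open set. *)
Lemma measurable_zero_path d (T : measurableType d) (Z : T -> R -> R) :
  D_random_variable Z -> measurable [set w | forall t, 0 <= t <= 1 -> Z w t = 0].
Proof.
move=> [_ mZ]; rewrite (_ : [set _ | _] =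
  ~` (Z @^-1` [set f : R -> R | exists2 t, 0 <= t <= 1 & f t <> 0])); last first.
  apply/seteqP; split => w /= H; first by move=> [t /H].
  by move=> t t01; apply: contrapT => Zt; apply: H; exists t.
apply: measurableC; apply: mZ; apply: sub_sigma_algebra; exact: open_nonzero.
Qed.

End SkorokhodContinuity.

(** * Measurability *)

Section MeasurableContinuousMap.
Context {R : realType} {d} {T : measurableType d}.

Lemma measurable_countable_comp (I : countType) (c : T -> I) (h : I -> R) :
  (forall i, measurable (c @^-1` [set i])) -> measurable_fun setT (h \o c).
Proof.
move=> mc _ Y _; rewrite setTI.
rewrite (_ : _ @^-1` Y = \bigcup_i (if `[< Y (h i) >] then c @^-1` [set i] else set0)).
  apply: countable_bigcupT_measurable => // i.
  by case: ifP.
apply/seteqP; split=> [w /= Yw|w [i _]].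
  by exists (c w) => //; rewrite asboolT.
by case: ifPn => // /asboolP Yi /= ->.
Qed.

(* y is approximated by its rounding to multiples of 1/(j+1), which takes
   countably many values. *)
Lemma measurable_continuous_map n (y : 'I_n -> T -> R) (Phi : ('I_n -> R) -> R) :
  (forall i, measurable_fun setT (y i)) ->
  (forall x e, 0 < e -> exists2 del, 0 < del &
     forall x', (forall i, `|x i - x' i| < del) -> `|Phi x - Phi x'| < e) ->
  measurable_fun setT (fun w => Phi (fun i => y i w)).
Proof.
move=> my cPhi.
pose c j (w : T) : {ffun 'I_n -> int} := [ffun i => Num.floor (y i w * j.+1%:R)].
pose h j (z : {ffun 'I_n -> int}) : R := Phi (fun i => (z i)%:~R / j.+1%:R).
apply: (@measurable_fun_cvg _ _ R _ (fun j => h j \o c j)).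
  move=> j; apply: measurable_countable_comp => z.
  rewrite (_ : _ @^-1` _ = \bigcap_(i in setT)
     ((fun w => y i w * j.+1%:R) @^-1` `[(z i)%:~R, (z i + 1)%:~R[%classic)).
    have : finite_set [set: 'I_n] by [].
    move=> fin; apply: fin_bigcap_measurable => // i _.
    rewrite -[X in measurable X]setTI; apply: measurable_funM => //.
  apply/seteqP; split=> w /=.
    by move=> <- i _ /=; rewrite in_itv/= ffunE floor_itv.
  move=> H; apply/ffunP => i; rewrite ffunE; apply: floor_def.
  by have := H i I; rewrite /= in_itv.
move=> w _; apply/cvgrPdist_lt => e e0.
have [del del0 H] := cPhi (fun i => y i w) e e0.
near=> j; apply: H => i; rewrite ffunE.
have j0 : 0 < j.+1%:R :> R by [].
have jd : j.+1%:R^-1 < del by near: j; exact: near_infty_natSinv_lt (PosNum del0).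
apply: le_lt_trans jd.
have := floor_itv (y i w * j.+1%:R); set z := Num.floor _ => /andP[z1 z2].
rewrite -[y i w](mulfK (lt0r_neq0 j0)) -mulrBl normrM.
rewrite [X in _ * X]ger0_norm ?invr_ge0// ler_piMl ?invr_ge0//.
by move: z2; rewrite intrD ler_norml => z2; apply/andP; split; lra.
Unshelve. all: by end_near. Qed.

Lemma measurable_continuous2 (F : R * R -> R) (y1 y2 : T -> R) :
  continuous F -> measurable_fun setT y1 -> measurable_fun setT y2 ->
  measurable_fun setT (fun w => F (y1 w, y2 w)).
Proof.
move=> cF m1 m2.
pose y (i : 'I_2) := if i == ord0 then y1 else y2.
pose Phi (x : 'I_2 -> R) := F (x ord0, x ord_max).
apply: (measurable_continuous_map 2 y Phi).
  by move=> i; rewrite /y; case: ifP.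
move=> x e e0; have /cvgrPdist_lt/(_ e e0) := cF (x ord0, x ord_max).
move=> /nbhs_ballP[r /= r0 Hr]; exists r => // x' xx'.
by apply: Hr; split; exact: xx'.
Qed.

End MeasurableContinuousMap.

(** * Step paths and Skorokhod-continuous functionals of them *)

Section StepPaths.
Context {R : realType}.
Implicit Types (s : nat -> R) (F : (R -> R) -> R).

(** [partial_sum_process] unfolds to this, with [s] the normalised partial sums. The value [s n] is
    read at time 1 and, for positive [n], nowhere else on [[0, 1]]. *)
Definition step_path n s : R -> R := fun t => s (Num.truncn (n%:R * t)).

Lemma step_path_cadlag n s : cadlag (step_path n s).
Proof.
have [->|n0] := posnP n.
  rewrite (_ : step_path 0 s = cst (s 0%N)); last first.
    by apply/funext => t; rewrite /step_path mul0r truncn0.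
  by split=> *; [exact: cvg_cst|exact: is_cvg_cst].
have n0' : 0 < n%:R :> R by rewrite ltr0n.
split=> t t0 t1.
  have /andP[m1 m2] : (Num.truncn (n%:R * t))%:R <= n%:R * t
      < (Num.truncn (n%:R * t)).+1%:R by rewrite truncn_itv// mulr_ge0// ltW.
  apply: cvg_near_cst; near=> x; rewrite /step_path; congr s.
  apply: truncn_def; apply/andP; split.
    by rewrite (le_trans m1)// ler_wpM2l ?ltW//; near: x; exact: nbhs_right_gt.
  rewrite mulrC -ltr_pdivlMr//; near: x; apply: nbhs_right_lt.
  by rewrite ltr_pdivlMr// mulrC.
have nt0 : 0 < n%:R * t by rewrite mulr_gt0.
(* The left limit at [t] reads [s m], where [m] is one below [truncn (n * t)] when [n * t] is an
   integer. *)
have [m m1 m2] : exists2 m : nat, m%:R < n%:R * t & n%:R * t <= m.+1%:R.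
  have /andP[m1 m2] := truncn_itv (ltW nt0).
  move: m1; rewrite le_eqVlt => /predU1P[m1|m1]; last first.
    by exists (Num.truncn (n%:R * t)) => //; exact: ltW.
  case E : (Num.truncn (n%:R * t)) => [|k].
    by move: m1 nt0; rewrite E => <-; rewrite ltxx.
  by exists k; rewrite -m1 E// ltr_nat.
apply/cvg_ex; exists (s m); apply: cvg_near_cst; near=> x.
rewrite /step_path; congr s; apply: truncn_def; apply/andP; split.
  apply/ltW; rewrite mulrC -ltr_pdivrMr//; near: x; apply: nbhs_left_gt.
  by rewrite ltr_pdivrMr// mulrC.
apply: lt_le_trans m2; rewrite ltr_pM2l//; near: x; exact: nbhs_left_lt.
Unshelve. all: by end_near. Qed.

Lemma step_path_const n s k t : (0 < n)%N ->
  k%:R / n%:R <= t < k.+1%:R / n%:R -> step_path n s t = s k.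
Proof.
move=> n0; have n0' : 0 < n%:R :> R by rewrite ltr0n.
rewrite ler_pdivrMr// ltr_pdivlMr// mulrC => H.
by rewrite /step_path (truncn_def H).
Qed.

Lemma step_path1 n s : step_path n s 1 = s n.
Proof. by rewrite /step_path mulr1 natrK. Qed.

Lemma truncn_le_n n t : 0 <= t <= 1 -> (Num.truncn (n%:R * t : R) <= n)%N.
Proof.
move=> /andP[t0 t1]; rewrite -(ler_nat R).
have /andP[m1 _] : (Num.truncn (n%:R * t))%:R <= n%:R * t
      < (Num.truncn (n%:R * t)).+1%:R by rewrite truncn_itv// mulr_ge0.
by rewrite (le_trans m1)// ler_piMr.
Qed.

(** Elements of D are represented by functions on the whole line; this shows that a
    Skorokhod-continuous functional sees [[0, 1]] only. *)
Lemma skc_ext F f g : skorokhod_continuous F -> cadlag f -> cadlag g ->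
  (forall t, 0 <= t <= 1 -> f t = g t) -> F f = F g.
Proof.
move=> cF cf cg fg; apply/eqP; rewrite -subr_eq0 -normr_le0.
apply/ler_addgt0Pr => e e0; rewrite add0r.
have [del del0 H] := skc_uniform F f e cF cf e0.
by apply/ltW/H => // t t01; rewrite fg// subrr normr0.
Qed.

(** A functional of a step path is a continuous function of the finitely many values
    [s 0, ..., s n]; measurability of the path as a map into D is thereby bypassed. *)
Lemma measurable_step_path d (T : measurableType d) n (s : nat -> T -> R) F :
  (forall k, measurable_fun setT (s k)) -> skorokhod_continuous F ->
  measurable_fun setT (fun w => F (step_path n (fun k => s k w))).
Proof.
move=> ms cF.
pose Phi (x : 'I_n.+1 -> R) := F (step_path n (fun k => x (inord k))).
have := @measurable_continuous_map R d T n.+1 (fun i => s i) Phi.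
have -> : (fun w => Phi (fun i => s i w)) = fun w => F (step_path n (fun k => s k w)).
  apply/funext => w; apply: skc_ext => //; try exact: step_path_cadlag.
  by move=> t t01; rewrite /step_path inordK// ltnS truncn_le_n.
apply=> // x e e0.
have [del del0 H] := skc_uniform F _ e cF (step_path_cadlag n (fun k => x (inord k))) e0.
exists del => // x' xx'; apply: H; first exact: step_path_cadlag.
by move=> t _; exact: xx'.
Qed.

End StepPaths.

(** * Weak convergence *)

Section Mean.
Context {R : realType} {d} {T : measurableType d} (P : probability T R).
Implicit Types (f g : T -> R) (A B : set T).

Definition pr A : R := fine (P A).
Definition mean f : R := Rintegral P setT f.

Lemma EFin_pr A : measurable A -> P A = (pr A)%:E.
Proof. by move=> mA; rewrite /pr fineK// fin_num_measure. Qed.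

Lemma pr_ge0 A : 0 <= pr A.
Proof. exact: fine_ge0. Qed.

Lemma pr_le1 A : measurable A -> pr A <= 1.
Proof. by move=> mA; rewrite -lee_fin -EFin_pr// probability_le1. Qed.

Lemma le_pr A B : measurable A -> measurable B -> A `<=` B -> pr A <= pr B.
Proof.
by move=> mA mB AB; rewrite -lee_fin -!EFin_pr// le_measure ?inE.
Qed.

Lemma prU A B : measurable A -> measurable B -> pr (A `|` B) <= pr A + pr B.
Proof.
move=> mA mB; rewrite -lee_fin EFinD -!EFin_pr//; last exact: measurableU.
exact: measureU2.
Qed.

Lemma prob_integrable f M : measurable_fun setT f -> (forall w, `|f w| <= M) ->
  P.-integrable setT (EFin \o f).
Proof.
move=> mf fM; apply: measurable_bounded_integrable => //.
  exact: (le_lt_trans (probability_le1 P measurableT) (ltry _)).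
exists M; split; first exact: num_real.
by move=> K MK x _ /=; rewrite (le_trans (fM x))// ltW.
Qed.

Lemma EFin_mean f M : measurable_fun setT f -> (forall w, `|f w| <= M) ->
  (\int[P]_w (f w)%:E)%E = (mean f)%:E.
Proof.
move=> mf fM; rewrite /mean /Rintegral fineK//.
by apply: integrable_fin_num => //; exact: prob_integrable fM.
Qed.

Lemma le_mean f g M K : measurable_fun setT f -> measurable_fun setT g ->
  (forall w, `|f w| <= M) -> (forall w, `|g w| <= K) ->
  (forall w, f w <= g w) -> mean f <= mean g.
Proof.
move=> mf mg fM gK fg; apply: le_Rintegral => //.
- exact: prob_integrable fM.
- exact: prob_integrable gK.
Qed.

Lemma mean_indic B : measurable B -> mean \1_B = pr B.
Proof. by move=> mB; rewrite /mean /Rintegral integral_indic// setIT. Qed.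

(** The form in which one statistic is exchanged for another: error [e] off [B], the trivial bound
    [2 * M] on it. *)
Lemma mean_close f g M e B : measurable_fun setT f -> measurable_fun setT g ->
  (forall w, `|f w| <= M) -> (forall w, `|g w| <= M) -> measurable B -> 0 <= e ->
  (forall w, ~ B w -> `|f w - g w| <= e) ->
  `|mean f - mean g| <= e + 2 * M * pr B.
Proof.
move=> mf mg fM gM mB e0 fg.
have M0 : 0 <= M by rewrite (le_trans _ (fM point)).
have mI : measurable_fun setT (\1_B : T -> R) by exact: measurable_indic.
have iI : P.-integrable setT (EFin \o \1_B).
  apply: (prob_integrable _ 1) => // w; rewrite indicE.
  by case: (_ \in _); rewrite ?normr1 ?normr0.
have if_ := prob_integrable f M mf fM; have ig := prob_integrable g M mg gM.
have i_fg : P.-integrable setT (EFin \o (fun w => f w - g w)).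
  apply: (prob_integrable _ (M + M)); first exact: measurable_funB.
  by move=> w; rewrite (le_trans (ler_normB _ _))// lerD.
have iB : P.-integrable setT (EFin \o (fun w => 2 * M * \1_B w)).
  apply: (prob_integrable _ (2 * M)); first exact: measurable_funM.
  move=> w; rewrite indicE; case: (_ \in _); rewrite ?mulr1 ?mulr0 ?normr0 ?mulr_ge0//.
  by rewrite ger0_norm// mulr_ge0.
have ic : P.-integrable setT (EFin \o (fun=> e)) by exact: (prob_integrable _ `|e|).
have -> : e + 2 * M * pr B = mean (fun w => e + 2 * M * \1_B w).
  rewrite /mean RintegralD// RintegralZl// Rintegral_cst// -/(mean \1_B) mean_indic//.
  by rewrite [X in fine X]probability_setT/= mulr1.
rewrite /mean -RintegralB//.
apply: (@le_trans _ _ (mean (fun w => `|f w - g w|))); first exact: le_normr_Rintegral.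
apply: (le_mean _ _ (M + M) (e + 2 * M)).
- by apply: measurableT_comp => //; exact: measurable_funB.
- by apply: measurable_funD => //; exact: measurable_funM.
- by move=> w; rewrite normr_id (le_trans (ler_normB _ _))// lerD.
- move=> w; rewrite indicE; case: (_ \in _); rewrite ?mulr1 ?mulr0 ?addr0 ger0_norm//.
  + by rewrite addr_ge0// mulr_ge0.
  + by rewrite lerDl mulr_ge0.
- move=> w; rewrite indicE; have [wB|wB] := boolP (w \in B).
    rewrite mulr1 (le_trans (ler_normB _ _))// mulr2n mulrDl mul1r.
    by rewrite -[leLHS]add0r lerD// lerD.
  by rewrite mulr0 addr0; apply: fg => Bw; move/negP: wB; apply; rewrite inE.
Qed.

Lemma pr_decr (F : (set T)^nat) e : (forall k, measurable (F k)) ->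
  (forall m n, (m <= n)%N -> F n `<=` F m) -> P (\bigcap_k F k) = 0%E -> 0 < e ->
  exists k, pr (F k) <= e.
Proof.
move=> mF dF F0 e0.
have : P \o F @ \oo --> P (\bigcap_k F k).
  apply: nonincreasing_cvg_mu => //.
  - exact: (le_lt_trans (probability_le1 P (mF _)) (ltry _)).
  - exact: bigcap_measurableType.
  - by move=> m n mn; apply/subsetPset; exact: dF.
rewrite F0 => /fine_cvg/cvgrPdist_le/(_ e e0)[k _ /(_ k (leqnn k))/=].
by rewrite sub0r normrN ger0_norm ?fine_ge0// => H; exists k.
Qed.

Lemma measurable_le_cst (X : T -> R) a : measurable_fun setT X ->
  measurable [set w | X w <= a].
Proof.
move=> mX; rewrite (_ : [set _ | _] = setT `&` X @^-1` `]-oo, a]%classic).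
  exact: mX.
by apply/seteqP; split=> w /=; rewrite in_itv//= => -[].
Qed.

Lemma measurable_ge_cst (X : T -> R) a : measurable_fun setT X ->
  measurable [set w | a <= X w].
Proof.
move=> mX; rewrite (_ : [set _ | _] = setT `&` X @^-1` `[a, +oo[%classic).
  exact: mX.
by apply/seteqP; split=> w /=; rewrite in_itv/= andbT// => -[].
Qed.

Lemma pr_small (X : T -> R) e : measurable_fun setT X ->
  P [set w | X w <= 0] = 0%E -> 0 < e ->
  exists2 del, 0 < del & pr [set w | X w <= del] <= e.
Proof.
move=> mX X0 e0.
have [||||k Hk] := pr_decr (fun k => [set w | X w <= k.+1%:R^-1]) e.
- by move=> k; exact: measurable_le_cst.
- move=> m n mn w /= Xn; apply: le_trans Xn _.
  by rewrite lef_pV2 ?posrE// ler_nat.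
- rewrite (_ : \bigcap_k _ = [set w | X w <= 0])//.
  apply/seteqP; split=> w /= H; last by move=> k _; rewrite /= (le_trans H).
  rewrite leNgt; apply/negP => Xw.
  have : \forall k \near \oo, k.+1%:R^-1 < X w by exact: near_infty_natSinv_lt (PosNum Xw).
  move=> [k _ /(_ k (leqnn k))/= Hk].
  by have := H k I; rewrite /= leNgt Hk.
- exact: e0.
by exists k.+1%:R^-1.
Qed.

Lemma pr_tail (X : T -> R) e : measurable_fun setT X -> 0 < e ->
  exists2 K, 0 < K & pr [set w | K <= X w] <= e.
Proof.
move=> mX e0.
have [||||k Hk] := pr_decr (fun k => [set w | k.+1%:R <= X w]) e.
- by move=> k; exact: measurable_ge_cst.
- by move=> m n mn w /=; apply: le_trans; rewrite ler_nat.
- rewrite (_ : \bigcap_k _ = set0) ?measure0//.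
  apply/seteqP; split=> w //= H.
  have := H (Num.truncn (X w)) I; rewrite /= leNgt => /negP; apply.
  exact: truncnS_gt.
- exact: e0.
by exists k.+1%:R.
Qed.

End Mean.

(** * Portmanteau inequalities and tightness for Skorokhod-continuous functionals *)

Section Portmanteau.
Context {R : realType} {d} {T : measurableType d} (P : probability T R)
  {d'} {T' : measurableType d'} (P' : probability T' R).
Implicit Types (F : (R -> R) -> R).

Lemma cvg_mean (f : nat -> T -> R) (g : T' -> R) M :
  (forall n, measurable_fun setT (f n)) -> measurable_fun setT g ->
  (forall n w, `|f n w| <= M) -> (forall w, `|g w| <= M) ->
  (\int[P]_w (f n w)%:E)%E @[n --> \oo] --> (\int[P']_w (g w)%:E)%E <->
  mean P (f n) @[n --> \oo] --> mean P' g.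
Proof.
move=> mf mg fM gM; rewrite (EFin_mean _ _ M)//; split=> [/fine_cvg//|H].
apply: cvg_EFin => //; near=> n; rewrite (EFin_mean _ _ M)//.
Unshelve. all: by end_near. Qed.

Definition ramp (u v x : R) : R := Num.max 0 (Num.min 1 ((v - x) / (v - u))).

Lemma ramp_bound u v x : 0 <= ramp u v x <= 1.
Proof. by rewrite /ramp le_max lexx/= ge_max ler01 ge_min lexx. Qed.

Lemma ramp_eq1 u v x : u < v -> x <= u -> ramp u v x = 1.
Proof.
move=> uv xu; have vu : 0 < v - u by rewrite subr_gt0.
rewrite /ramp min_l ?max_r//.
by rewrite ler_pdivlMr// mul1r lerD2l lerN2.
Qed.

Lemma ramp_eq0 u v x : u < v -> v <= x -> ramp u v x = 0.
Proof.
move=> uv vx; have vu : 0 < v - u by rewrite subr_gt0.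
apply: max_l; rewrite ge_min; apply/orP; right.
by rewrite pmulr_lle0 ?invr_gt0// subr_le0.
Qed.

Lemma continuous_ramp u v : continuous (ramp u v).
Proof.
move=> x; apply: (@continuous_max R R (fun=> 0)
    ((fun=> 1) \min (fun x => (v - x) / (v - u)))); first exact: cvg_cst.
apply: (@continuous_min R R (fun=> 1)); first exact: cvg_cst.
apply: cvgM; last exact: cvg_cst.
by apply: cvgB; [exact: cvg_cst|exact: cvg_id].
Qed.

Variables (s : nat -> nat -> T -> R) (Z : T' -> R -> R).
Hypothesis ms : forall n k, measurable_fun setT (s n k).
Hypothesis DZ : D_random_variable Z.
Let V n w := step_path n (fun k => s n k w).
Hypothesis VZ : cvg_dist_D P V P' Z.

Lemma cvg_mean_skc F M : skorokhod_continuous F -> (forall f, `|F f| <= M) ->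
  mean P (fun w => F (V n w)) @[n --> \oo] --> mean P' (fun w => F (Z w)).
Proof.
move=> cF FM; apply/(cvg_mean _ _ M) => //.
- by move=> n; exact: measurable_step_path.
- exact: skc_measurable.
- by apply: VZ => //; exists M.
Qed.

Lemma measurable_FV F n : skorokhod_continuous F ->
  measurable_fun setT (fun w => F (V n w)).
Proof. by move=> cF; exact: measurable_step_path. Qed.

Lemma measurable_FZ F : skorokhod_continuous F ->
  measurable_fun setT (fun w => F (Z w)).
Proof. exact: skc_measurable. Qed.

Lemma mean_ramp d0 (U : measurableType d0) (Q : probability U R) (X : U -> R) u v :
  u < v -> measurable_fun setT X ->
  pr Q [set w | X w <= u] <= mean Q (fun w => ramp u v (X w)) <= pr Q [set w | X w <= v].
Proof.
move=> uv mX.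
have mr : measurable_fun setT (fun w => ramp u v (X w)).
  by apply: measurableT_comp => //; apply: continuous_measurable_fun; exact: continuous_ramp.
have b1 w : `|ramp u v (X w)| <= 1.
  by have /andP[? ?] := ramp_bound u v (X w); rewrite ger0_norm.
have ind1 (B : set U) w : `|\1_B w| <= 1 :> R.
  by rewrite indicE; case: (_ \in _); rewrite ?normr1 ?normr0.
rewrite -!mean_indic; try exact: measurable_le_cst.
apply/andP; split; apply: (le_mean _ _ _ 1 1) => //.
- by apply: measurable_indic; exact: measurable_le_cst.
- move=> w; rewrite indicE; have [|] := boolP (w \in _).
    by rewrite inE/= => Xu; rewrite ramp_eq1.
  by have /andP[] := ramp_bound u v (X w).
- by apply: measurable_indic; exact: measurable_le_cst.
- move=> w; rewrite indicE; have [|] := boolP (w \in _).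
    by have /andP[] := ramp_bound u v (X w).
  by rewrite notin_setE/= => /negP; rewrite -ltNge => /ltW Xv; rewrite ramp_eq0.
Qed.

(** The ramp lies between the indicators of [x <= u] and [x <= v]. The gap between [u] and [v]
    replaces the usual restriction to continuity points. *)
Lemma portmanteau F u v e : skorokhod_continuous F -> u < v -> 0 < e ->
  \forall n \near \oo,
    pr P [set w | F (V n w) <= u] <= pr P' [set w | F (Z w) <= v] + e /\
    pr P' [set w | F (Z w) <= u] <= pr P [set w | F (V n w) <= v] + e.
Proof.
move=> cF uv e0.
have cr : skorokhod_continuous (ramp u v \o F).
  by apply: skc_comp => //; exact: continuous_ramp.
have b1 f : `|(ramp u v \o F) f| <= 1.
  by have /andP[? ?] := ramp_bound u v (F f); rewrite /= ger0_norm.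
have /cvgrPdist_le/(_ e e0) := cvg_mean_skc _ 1 cr b1.
apply: filterS => n /=; rewrite ler_distl => /andP[h1 h2].
have /andP[h3 h4] := mean_ramp _ _ P (fun w => F (V n w)) _ _ uv (measurable_FV F n cF).
have /andP[h5 h6] := mean_ramp _ _ P' (fun w => F (Z w)) _ _ uv (measurable_FZ F cF).
by split; lra.
Qed.

(** The upper tail of [F (Z w)] is small far out, and the inequality for [- F] transfers this to all
    large [n]. *)
Lemma tight_skc F e : skorokhod_continuous F -> 0 < e ->
  exists2 K, 0 < K & \forall n \near \oo, pr P [set w | K <= F (V n w)] <= e.
Proof.
move=> cF e0; have e20 : 0 < e / 2 by lra.
have [K K0 HK] := pr_tail P' _ _ (measurable_FZ F cF) e20.
have cN : skorokhod_continuous (fun f => - F f).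
  apply: (@skc_comp _ F (fun x => - x)) => //.
  by move=> x; apply: cvgN; exact: cvg_id.
have K1 : - (K + 1) < - K by lra.
exists (K + 1); first lra.
have := portmanteau _ _ _ _ cN K1 e20; apply: filterS => n [+ _].
have -> : [set w | - F (V n w) <= - (K + 1)] = [set w | K + 1 <= F (V n w)].
  by apply/seteqP; split=> w /=; rewrite lerN2.
have -> : [set w | - F (Z w) <= - K] = [set w | K <= F (Z w)].
  by apply/seteqP; split=> w /=; rewrite lerN2.
by lra.
Qed.

End Portmanteau.

(** * AR(1) sequences and their continuous-time approximation *)

Section Discretization.
Context {R : realType}.
Implicit Types (s x : nat -> R) (gam M K C eta e : R).

Lemma riemann_sum_close (f : R -> R) (c : nat -> R) n eta : (0 < n)%N -> bdm f ->
  (forall k u, (k < n)%N -> k%:R / n%:R <= u < k.+1%:R / n%:R -> `|f u - c k| <= eta) ->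
  `|n%:R^-1 * (\sum_(k < n) c k) - iint f 0 1| <= eta.
Proof.
move=> n0 bf H; have n0' : 0 < n%:R :> R by rewrite ltr0n.
have le1 k : (k <= n)%N -> k%:R / n%:R <= 1 :> R.
  by move=> kn; rewrite ler_pdivrMr// mul1r ler_nat.
suff main m : (m <= n)%N ->
    `|n%:R^-1 * (\sum_(k < m) c k) - iint f 0 (m%:R / n%:R)| <= m%:R / n%:R * eta.
  by have := main n (leqnn n); rewrite divff ?gt_eqF// mul1r.
elim: m => [_|m IH mn].
  by rewrite big_ord0 mulr0 !mul0r /iint set_itv1 Rintegral_set1 subrr normr0.
have h0 : 0 <= m%:R / n%:R :> R by rewrite divr_ge0.
have hS : m%:R / n%:R <= m.+1%:R / n%:R :> R by rewrite ler_pM2r ?invr_gt0// ler_nat.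
have hS1 := le1 _ mn.
have wE : m.+1%:R / n%:R - m%:R / n%:R = n%:R^-1 :> R.
  by rewrite -mulrBl -natr1 [X in X - _]addrC addrK mul1r.
rewrite big_ord_recr/= (iint_split f 0 (m%:R / n%:R))//.
have H1 : `|iint (fun u => f u - c m) (m%:R / n%:R) (m.+1%:R / n%:R)| <= eta * n%:R^-1.
  rewrite -[X in _ <= _ * X]wE; apply: iint_bound => //.
    by apply: (bdmB f (fun=> c m)) => //; exact: bdm_cst.
  by move=> u; exact: H.
rewrite (@iintB _ f (fun=> c m)) ?iint_cst ?wE// in H1; last exact: bdm_cst.
rewrite mulrDr.
set A := _ * \sum_(_ < _) _; set B := iint f 0 _; set D := iint f _ _.
rewrite (_ : A + n%:R^-1 * c m - (B + D) = (A - B) - (D - c m * n%:R^-1)); last by ring.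
rewrite (le_trans (ler_normB _ _))//.
rewrite (_ : m.+1%:R / n%:R * eta = m%:R / n%:R * eta + eta * n%:R^-1).
  by rewrite lerD// IH// ltnW.
by rewrite -[m.+1%:R]natr1; ring.
Qed.

Section Path.
Variables (n : nat) (s : nat -> R) (gam M : R).
Hypothesis n0 : (0 < n)%N.
Hypothesis s0 : s 0%N = 0.
Hypothesis sM : forall k, (k <= n)%N -> `|s k| <= M.
Let V := step_path n s.

Let n0' : 0 < n%:R :> R. Proof. by rewrite ltr0n. Qed.

Let bV : bdm V. Proof. by apply: cadlag_bdm; exact: step_path_cadlag. Qed.

Let le1 k : (k <= n)%N -> k%:R / n%:R <= 1 :> R.
Proof. by move=> kn; rewrite ler_pdivrMr// mul1r ler_nat. Qed.

Let ge0 k : 0 <= k%:R / n%:R :> R. Proof. by rewrite divr_ge0. Qed.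

Let leS k : k%:R / n%:R <= k.+1%:R / n%:R :> R.
Proof. by rewrite ler_pM2r ?invr_gt0// ler_nat. Qed.

Let ltS k : k%:R / n%:R < k.+1%:R / n%:R :> R.
Proof. by rewrite ltr_pM2r ?invr_gt0// ltr_nat. Qed.

Let width k : k.+1%:R / n%:R - k%:R / n%:R = n%:R^-1 :> R.
Proof. by rewrite -mulrBl -natr1 [X in X - _]addrC addrK mul1r. Qed.

Let Vk k : V (k%:R / n%:R) = s k.
Proof. by apply: step_path_const => //; rewrite lexx ltS. Qed.

Lemma step_path_bound t : 0 <= t <= 1 -> `|V t| <= M.
Proof. by move=> t01; apply: sM; exact: truncn_le_n. Qed.

Let VM t : 0 <= t < 1 -> `|V t| <= M.
Proof. by move=> /andP[t0 t1]; rewrite step_path_bound// t0 ltW. Qed.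

Let Ob t : 0 <= t <= 1 -> `|OU gam V t| <= (1 + `|gam| * expR `|gam|) * M.
Proof. by move=> t01; apply: OU_bound => //; exact: step_path_bound. Qed.

(* Exactly an AR(1) recursion, so comparing it with the model only involves the
   coefficients beta_n and exp(-gam/n). *)
Lemma OU_step t : (t < n)%N -> OU gam V (t.+1%:R / n%:R) =
  expR (- gam / n%:R) * OU gam V (t%:R / n%:R) + (s t.+1 - s t).
Proof.
move=> tn; rewrite !OU_expconv !Vk (expconv_step gam V (t%:R / n%:R))//; last exact: le1.
rewrite width.
rewrite (@eq_iint _ _ (fun u => s t * expR (- gam * (t.+1%:R / n%:R - u)))).
- rewrite iintZ//; [|exact: bdm_expR|exact: le1].
  have := iint_expR gam (t.+1%:R / n%:R) _ _ (leS t).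
  rewrite subrr mulr0 expR0 width => E.
  move: E; set I := iint _ _ _; set J := expconv _ _ _ => E.
  rewrite (_ : _ - gam * _ = s t.+1 - gam * expR (- gam * n%:R^-1) * J - s t * (gam * I));
    last by ring.
  by rewrite E; ring.
- exact: bdm_expf.
- by apply: bdmZ; exact: bdm_expR.
- by [].
- exact: le1.
- by move=> u tu; rewrite [V u](step_path_const n s t)// mulrC.
Qed.

Lemma OU_grid_const t u : (t < n)%N -> t%:R / n%:R <= u < t.+1%:R / n%:R ->
  `|OU gam V u - OU gam V (t%:R / n%:R)| <= `|gam| * (lipK gam * M / n%:R).
Proof.
move=> tn /andP[tu ut]; rewrite !OU_expconv Vk [V u](step_path_const n s t)//; last first.
  by rewrite tu.
rewrite (_ : _ - _ = - (gam * (expconv gam V u - expconv gam V (t%:R / n%:R)))); last ring.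
rewrite normrN normrM ler_wpM2l//.
have u1 : u <= 1 by rewrite (le_trans (ltW ut))// le1.
apply: (le_trans (@expconv_lip _ gam V M _ _ bV (ge0 t) tu u1 VM)).
have M0 : 0 <= M by rewrite (le_trans _ (sM 0 _)).
rewrite ler_wpM2l ?mulr_ge0 ?lipK_ge0// -[leRHS](width t) lerD2r; exact: ltW.
Qed.

(** A discrete Gronwall argument: the error satisfies an AR(1) recursion with coefficient [b],
    forced by [(b - expR (- gam / n)) * OU]. Over [n] steps [b] amplifies by at most [expR C], and
    forcing terms of size [del * K / n] add up to [del * K]. *)
Lemma ar_OU_close x b C del : 0 <= C -> 0 <= del ->
  `|b| <= 1 + C / n%:R -> `|b - expR (- gam / n%:R)| <= del / n%:R ->
  (forall t, (t < n)%N -> x t.+1 = b * x t + (s t.+1 - s t)) ->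
  forall t, (t <= n)%N -> `|x t - OU gam V (t%:R / n%:R)| <=
    expR C * (`|x 0%N| + del * ((1 + `|gam| * expR `|gam|) * M)).
Proof.
move=> C0 del0 hb hd hx; set K := (1 + `|gam| * expR `|gam|) * M.
have K0 : 0 <= K by apply: le_trans (Ob 0 _); rewrite ?lexx ?ler01.
have c1 : 1 <= 1 + C / n%:R by rewrite lerDl divr_ge0.
have main t : (t <= n)%N -> `|x t - OU gam V (t%:R / n%:R)| <=
    (1 + C / n%:R) ^+ t * (`|x 0%N| + del * K * (t%:R / n%:R)).
  elim: t => [_|t IH tn].
    rewrite !mul0r mulr0 addr0 expr0 mul1r OU_expconv expconv0 mulr0 subr0.
    by have := Vk 0; rewrite mul0r => ->; rewrite s0 subr0.
  rewrite hx// OU_step//.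
  set D := x t - OU gam V (t%:R / n%:R).
  rewrite (_ : _ - _ = b * D + (b - expR (- gam / n%:R)) * OU gam V (t%:R / n%:R));
    last by rewrite /D; ring.
  have H1 : `|b * D| <= (1 + C / n%:R) * ((1 + C / n%:R) ^+ t *
      (`|x 0%N| + del * K * (t%:R / n%:R))).
    by rewrite normrM ler_pM// IH// ltnW.
  have H2 : `|(b - expR (- gam / n%:R)) * OU gam V (t%:R / n%:R)| <= del / n%:R * K.
    by rewrite normrM ler_pM// Ob// ge0 le1// ltnW.
  have H3 : del / n%:R * K <= (1 + C / n%:R) ^+ t.+1 * (del / n%:R * K).
    by apply: ler_peMl; [rewrite mulr_ge0// divr_ge0|exact: exprn_ege1].
  rewrite (le_trans (ler_normD _ _))//.
  rewrite (_ : _ ^+ t.+1 * _ = (1 + C / n%:R) * ((1 + C / n%:R) ^+ t *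
      (`|x 0%N| + del * K * (t%:R / n%:R))) + (1 + C / n%:R) ^+ t.+1 * (del / n%:R * K)).
    by apply: lerD => //; exact: le_trans H3.
  by rewrite exprS -[t.+1%:R]natr1; ring.
move=> t tn; apply: le_trans (main t tn) _.
have P0 : 0 <= `|x 0%N| + del * K * (t%:R / n%:R) by apply: addr_ge0 => //; apply: mulr_ge0; [exact: mulr_ge0|exact: ge0].
rewrite ler_pM//; first by rewrite exprn_ge0// (le_trans ler01).
  apply: (@le_trans _ _ ((1 + C / n%:R) ^+ n)); first by rewrite ler_weXn2l.
  have -> : expR C = expR (C / n%:R) ^+ n by rewrite -expRM_natl mulrC divfK// gt_eqF.
  by rewrite lerXn2r ?nnegrE ?expR_ge0 ?(le_trans ler01)// expR_ge1Dx.
by rewrite lerD2l; apply: ler_piMr; [exact: mulr_ge0|exact: le1].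
Qed.

End Path.

(** [expR (- u) >= 1 - u] gives one sign; [expR (- u) * (1 + u) <= 1] together with [1 + u >= 1/2]
    gives the other. *)
Lemma expR_quad (u : R) : `|u| <= 2^-1 -> `|1 - expR (- u) - u| <= 2 * u ^+ 2.
Proof.
rewrite ler_norml => /andP[u1 u2].
have h1 := expR_ge1Dx (- u).
have h2 : expR (- u) * (1 + u) <= 1.
  have E : expR (- u) * expR u = 1 by rewrite -expRD addNr expR0.
  by rewrite -[leRHS]E ler_wpM2l ?expR_ge0// expR_ge1Dx.
rewrite ler_norml; apply/andP; split; first by nra.
by have := sqr_ge0 u; lra.
Qed.

(** * The nearly unstable coefficient and its exponential substitute *)

Section NearlyUnstable.
Variables (beta : nat -> R) (gam : R).
Hypothesis hbeta : (n%:R * (1 - beta n)) @[n --> \oo] --> gam.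

Lemma near_inv e : 0 < e -> \forall n \near \oo, (0 < n)%N /\ n%:R^-1 <= e :> R.
Proof.
move=> e0; near=> n; split; first by near: n; exact: nbhs_infty_gt.
have n0 : (0 < n)%N by near: n; exact: nbhs_infty_gt.
rewrite -[leRHS]invrK lef_pV2 ?posrE ?invr_gt0 ?ltr0n//.
by near: n; exact: nbhs_infty_ger.
Unshelve. all: by end_near. Qed.

(** Both coefficients are [1 - gam / n + o(1/n)]. The rate [o(1/n)] is what is needed, since
    coefficient errors accumulate over [n] steps. *)
Lemma beta_expR_close del : 0 < del ->
  \forall n \near \oo, `|beta n - expR (- gam / n%:R)| <= del / n%:R.
Proof.
move=> del0; have d2 : 0 < del / 2 by lra.
have /cvgrPdist_le/(_ _ d2) h1 := hbeta.
have c0 : 0 < del / 2 / (2 * gam ^+ 2 + 1).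
  by rewrite divr_gt0//; have := sqr_ge0 gam; lra.
have c1 : 0 < 2^-1 / (`|gam| + 1) :> R by rewrite divr_gt0// ltr_wpDl.
near=> n.
have [n0 n1] : (0 < n)%N /\ n%:R^-1 <= del / 2 / (2 * gam ^+ 2 + 1).
  by near: n; exact: near_inv.
have [_ n2] : (0 < n)%N /\ n%:R^-1 <= 2^-1 / (`|gam| + 1).
  by near: n; exact: near_inv.
have h : `|gam - n%:R * (1 - beta n)| <= del / 2 by near: n.
have n0' : 0 < n%:R :> R by rewrite ltr0n.
have gn : `|gam / n%:R| <= 2^-1.
  rewrite normrM [X in _ * X]ger0_norm ?invr_ge0//.
  rewrite ler_pdivlMr in n2; last by rewrite ltr_wpDl.
  by rewrite mulrC; have := invr_ge0 (n%:R : R); rewrite ler0n; nra.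
have := expR_quad _ gn.
set E := expR _; have -> : E = expR (- gam / n%:R) by rewrite /E mulNr.
move=> {E}; set E := expR _ => hE.
have hq : 2 * (gam / n%:R) ^+ 2 <= del / 2 / n%:R.
  rewrite exprMn expr2 (_ : _ ^-1 ^+ 2 = n%:R^-1 * n%:R^-1); last by rewrite expr2.
  rewrite ler_pdivlMr in n1; last by have := sqr_ge0 gam; lra.
  have := invr_ge0 (n%:R : R); rewrite ler0n => i0.
  rewrite mulrA mulrA ler_wpM2r//.
  by have := sqr_ge0 gam; rewrite expr2 in n1 *; nra.
have -> : beta n - E = (gam - n%:R * (1 - beta n)) / n%:R + (1 - E - gam / n%:R).
  by field; rewrite gt_eqF.
rewrite (le_trans (ler_normD _ _))// normrM [X in _ * X + _]ger0_norm ?invr_ge0//.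
have h' : `|gam - n%:R * (1 - beta n)| / n%:R <= del / 2 / n%:R by rewrite ler_wpM2r ?invr_ge0.
by rewrite (_ : del / n%:R = del / 2 / n%:R + del / 2 / n%:R); [|field; rewrite gt_eqF]; lra.
Unshelve. all: by end_near. Qed.

Lemma beta_bound : \forall n \near \oo, `|beta n| <= 1 + (`|gam| + 1) / n%:R.
Proof.
have /cvgrPdist_le/(_ _ ltr01) h1 := hbeta.
near=> n.
have n0 : (0 < n)%N by near: n; exact: nbhs_infty_gt.
have n0' : 0 < n%:R :> R by rewrite ltr0n.
have h : `|gam - n%:R * (1 - beta n)| <= 1 by near: n.
have -> : beta n = 1 + ((gam - n%:R * (1 - beta n)) - gam) / n%:R.
  by field; rewrite gt_eqF.
rewrite (le_trans (ler_normD _ _))// normr1 lerD2l normrM.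
rewrite [X in _ * X]ger0_norm ?invr_ge0// ler_wpM2r ?invr_ge0//.
by rewrite (le_trans (ler_normB _ _))// addrC lerD2l.
Unshelve. all: by end_near. Qed.

(** The threshold for [n] is fixed before [s] and [x], so that it can be used at every sample point
    whose path is bounded by [M]. *)
Lemma ar_functionals_close M e : 0 <= M -> 0 < e -> exists2 eta, 0 < eta &
  \forall n \near \oo, forall s x, s 0%N = 0 ->
    (forall k, (k <= n)%N -> `|s k| <= M) -> `|x 0%N| <= eta ->
    (forall t, (t < n)%N -> x t.+1 = beta n * x t + (s t.+1 - s t)) ->
    `|x n - OU gam (step_path n s) 1| <= e /\
    `|n%:R^-1 * (\sum_(t < n) x t ^+ 2) - sq_int (OU gam (step_path n s))| <= e.
Proof.
move=> M0 e0; pose K := (1 + `|gam| * expR `|gam|) * M; pose C := `|gam| + 1.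
have K0 : 0 <= K by rewrite mulr_ge0// addr_ge0// mulr_ge0// expR_ge0.
have K1 : 0 < 2 * K + 1 by lra.
(* [r] is the error allowed before squaring: at distance [r <= 1] the sum of the two values is at
   most [2 * K + 1]. One third of [r] each goes to the initial value, the mismatch of coefficients
   and the variation of [OU] within a grid cell. *)
pose r := Num.min 1 (e / (2 * K + 1)).
have r0 : 0 < r by rewrite lt_min ltr01 divr_gt0.
have r1 : r <= 1 by rewrite ge_min lexx.
have rK : r * (2 * K + 1) <= e by rewrite -ler_pdivlMr// ge_min lexx orbT.
have C0 : 0 <= C by rewrite addr_ge0.
have EC : 0 < expR C by exact: expR_gt0.
have eta0 : 0 < r / 3 / expR C by rewrite !divr_gt0.
exists (r / 3 / expR C) => //.
have K2 : 0 < K + 1 by lra.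
have del0 : 0 < r / 3 / expR C / (K + 1) by rewrite !divr_gt0.
have L0 : 0 < `|gam| * (lipK gam * M) + 1.
  by rewrite ltr_wpDl// !mulr_ge0// lipK_ge0.
have L1 : 0 < r / 3 / (`|gam| * (lipK gam * M) + 1) by rewrite !divr_gt0.
near=> n => s x s0 sM x0 hx.
have [n0 n1] : (0 < n)%N /\ n%:R^-1 <= r / 3 / (`|gam| * (lipK gam * M) + 1).
  by near: n; exact: near_inv.
have n0' : 0 < n%:R :> R by rewrite ltr0n.
have h1 : `|beta n| <= 1 + C / n%:R by near: n; exact: beta_bound.
have h2 : `|beta n - expR (- gam / n%:R)| <= r / 3 / expR C / (K + 1) / n%:R.
  by near: n; exact: beta_expR_close.
have M00 : 0 <= r / 3 / expR C / (K + 1) by exact: ltW.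
have cl t : (t <= n)%N -> `|x t - OU gam (step_path n s) (t%:R / n%:R)| <= 2 * (r / 3).
  move=> tn; apply: le_trans (ar_OU_close _ _ gam M n0 s0 sM x (beta n) _ _ C0 M00 h1 h2 hx t tn) _.
  rewrite -/K mulrDr; have -> : 2 * (r / 3) = r / 3 + r / 3 by lra.
  apply: lerD; first by rewrite -ler_pdivlMl// mulrC.
  rewrite -ler_pdivlMl// [leRHS]mulrC -mulrA ler_piMr ?(ltW eta0)//.
  by rewrite mulrC ler_pdivrMr//; lra.
split.
  have := cl n (leqnn n); rewrite divff ?gt_eqF// => /le_trans; apply.
  have : r * 1 <= r * (2 * K + 1) by rewrite ler_pM2l//; lra.
  by lra.
have bO : bdm (OU gam (step_path n s)).
  by apply: cadlag_bdm; apply: OU_cadlag; exact: step_path_cadlag.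
apply: (riemann_sum_close (fun u => OU gam (step_path n s) u ^+ 2) (fun t => x t ^+ 2)) => //.
  exact: bdmX.
move=> t u tn tu.
have Lr : `|gam| * (lipK gam * M / n%:R) <= r / 3.
  rewrite ler_pdivlMr// in n1.
  rewrite !mulrA; have i0 := ltW (divr_gt0 ltr01 n0'); rewrite div1r in i0.
  by rewrite -!mulrA in n1 *; nra.
have hd : `|OU gam (step_path n s) u - x t| <= r.
  have -> : OU gam (step_path n s) u - x t =
    (OU gam (step_path n s) u - OU gam (step_path n s) (t%:R / n%:R)) -
    (x t - OU gam (step_path n s) (t%:R / n%:R)) by ring.
  rewrite (le_trans (ler_normB _ _))//.
  have := cl t (ltnW tn).
  have := OU_grid_const n s gam M n0 sM t u tn tu.
  by lra.
have hO : `|OU gam (step_path n s) u| <= K.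
  have u01 : 0 <= u <= 1.
    case/andP: tu => tu ut; apply/andP; split.
      by apply: le_trans tu; rewrite divr_ge0.
    by apply: (le_trans (ltW ut)); rewrite ler_pdivrMr// mul1r ler_nat.
  have bV : bdm (step_path n s) by apply: cadlag_bdm; exact: step_path_cadlag.
  apply: OU_bound => //; last exact: step_path_bound.
  by move=> v /andP[v0 v1]; apply: step_path_bound => //; rewrite v0 ltW.
rewrite subr_sqr normrM; apply: le_trans rK; rewrite ler_pM//.
have -> : OU gam (step_path n s) u + x t =
   2 * OU gam (step_path n s) u - (OU gam (step_path n s) u - x t) by ring.
rewrite (le_trans (ler_normB _ _))// normrM ger0_norm//.
by lra.
Unshelve. all: by end_near. Qed.

End NearlyUnstable.

(** The bracket on the left equals the sum of [x t * w t]; it is written through [x] because this is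
    the numerator of [bhat - b]. The squares [x t.+1 ^+ 2 - x t ^+ 2] telescope. *)
Lemma ar_square_identity x b (w : nat -> R) n :
  (forall t, (t < n)%N -> x t.+1 = b * x t + w t) ->
  2 * b * (\sum_(t < n) x t.+1 * x t - b * \sum_(t < n) x t ^+ 2) =
  x n ^+ 2 - x 0%N ^+ 2 + (1 - b ^+ 2) * (\sum_(t < n) x t ^+ 2) - \sum_(t < n) w t ^+ 2.
Proof.
elim: n => [_|n IH hx]; first by rewrite !big_ord0; ring.
rewrite !big_ord_recr/=.
have {}IH := IH (fun t tn => hx t (ltnW tn)).
move: IH; set A := \sum_(t < n) _; set Q := \sum_(t < n) _; set W := \sum_(t < n) _ => IH.
rewrite (_ : 2 * b * (A + x n.+1 * x n - b * (Q + x n ^+ 2)) =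
  2 * b * (A - b * Q) + 2 * b * (x n.+1 * x n - b * x n ^+ 2)); last by ring.
by rewrite IH hx//; ring.
Qed.

Lemma prod_close (a a' b b' A B e1 e2 : R) : `|a - a'| <= e1 -> `|b - b'| <= e2 ->
  `|a'| <= A -> `|b'| <= B -> `|a * b - a' * b'| <= e1 * (B + e2) + A * e2.
Proof.
move=> h1 h2 hA hB.
have -> : a * b - a' * b' = (a - a') * b + a' * (b - b') by ring.
rewrite (le_trans (ler_normD _ _))// !normrM lerD// ler_pM//.
have -> : b = b' + (b - b') by ring.
by rewrite (le_trans (ler_normD _ _))// lerD.
Qed.

Lemma quad_close K (kap rho : R) gam : 0 <= K -> exists2 L, 0 < L &
  forall eta (r b g x y q W G1 G2 : R), eta <= 2^-1 ->
    `|r - rho| <= eta -> `|b - 1| <= eta -> `|g - 2 * gam| <= eta ->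
    `|x - G1| <= eta -> `|y| <= eta -> `|q - G2| <= eta -> `|W - kap| <= eta ->
    `|G1| <= K -> `|G2| <= K ^+ 2 ->
  `|(r * (x ^+ 2 - y ^+ 2 + g * q) - W) / (2 * b) -
    (rho * (G1 ^+ 2 + 2 * gam * G2) - kap) / 2| <= eta * L.
Proof.
move=> K0.
pose L1 := (2 * K + 1) + 1 + (2 * `|gam| + K ^+ 2 + 1).
pose Bb := K ^+ 2 + 2 * `|gam| * K ^+ 2.
pose L2 := Bb + L1 + `|rho| * L1.
pose Ab := `|rho| * Bb + `|kap|.
have g0 := normr_ge0 gam; have r0 := normr_ge0 rho; have k0 := normr_ge0 kap.
have K20 := sqr_ge0 K.
have gK0 : 0 <= `|gam| * K ^+ 2 by rewrite mulr_ge0.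
have L10 : 0 < L1 by rewrite /L1; lra.
have Bb0 : 0 <= Bb by rewrite /Bb; lra.
have rL0 : 0 <= `|rho| * L1 by rewrite mulr_ge0// ltW.
have rB0 : 0 <= `|rho| * Bb by rewrite mulr_ge0.
have L20 : 0 < L2 by rewrite /L2; lra.
have Ab0 : 0 <= Ab by rewrite /Ab; lra.
exists (2 * (L2 + 1) + 2 * Ab); first lra.
move=> eta r b g x y q W G1 G2 e12 hr hb hg hx hy hq hW hG1 hG2.
have e0 : 0 <= eta := le_trans (normr_ge0 _) hr.
have e2 : eta * eta <= eta by rewrite ler_piMr//; lra.
have h1 : `|x * x - G1 * G1| <= eta * (2 * K + 1).
  by apply: le_trans (prod_close _ _ _ _ _ _ _ _ hx hx hG1 hG1) _; lra.
have h2 : `|y * y| <= eta by rewrite normrM (le_trans _ e2)// ler_pM.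
have h3 : `|g * q - 2 * gam * G2| <= eta * (2 * `|gam| + K ^+ 2 + 1).
  have hg2 : `|2 * gam| <= 2 * `|gam| by rewrite normrM ger0_norm.
  by apply: le_trans (prod_close _ _ _ _ _ _ _ _ hg hq hg2 hG2) _; lra.
pose B := x ^+ 2 - y ^+ 2 + g * q; pose B0 := G1 ^+ 2 + 2 * gam * G2.
have h4 : `|B - B0| <= eta * L1.
  have -> : B - B0 = (x * x - G1 * G1) - y * y + (g * q - 2 * gam * G2).
    by rewrite /B /B0; ring.
  rewrite (le_trans (ler_normD _ _))//.
  have := ler_normB (x * x - G1 * G1) (y * y).
  by rewrite /L1; lra.
have hB0 : `|B0| <= Bb.
  rewrite (le_trans (ler_normD _ _))// /Bb lerD//.
    by rewrite normrX lerXn2r// nnegrE.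
  by rewrite !normrM ger0_norm// ler_wpM2l// mulr_ge0.
have h5 : `|r * B - rho * B0| <= eta * L2.
  apply: le_trans (prod_close _ _ _ _ _ _ _ _ hr h4 (lexx _) hB0) _.
  have : eta * (eta * L1) <= eta * L1 by rewrite mulrA ler_wpM2r// ltW.
  by rewrite /L2; lra.
pose A := r * B - W; pose A0 := rho * B0 - kap.
have h6 : `|A - A0| <= eta * (L2 + 1).
  have -> : A - A0 = (r * B - rho * B0) - (W - kap) by rewrite /A /A0; ring.
  by rewrite (le_trans (ler_normB _ _))//; lra.
have hA0 : `|A0| <= Ab.
  by rewrite (le_trans (ler_normB _ _))// /Ab lerD2r normrM ler_wpM2l.
(* [eta <= 1/2] keeps the divisor away from 0. *)
have b2 : 2^-1 <= b by move: hb; rewrite ler_distl => /andP[]; lra.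
have b0 : 0 < b by rewrite (lt_le_trans _ b2).
have h7 : `|b^-1 - 1| <= 2 * eta.
  have -> : b^-1 - 1 = (1 - b) / b by field; rewrite gt_eqF.
  rewrite normrM distrC [`|b^-1|]ger0_norm ?invr_ge0 ?(ltW b0)// mulrC.
  rewrite ler_pM ?invr_ge0 ?(ltW b0)//.
  by rewrite -[leRHS]invrK lef_pV2 ?posrE ?invr_gt0.
have h8 : `|A * b^-1 - A0 * 1| <= eta * (L2 + 1) * (1 + 2 * eta) + Ab * (2 * eta).
  by apply: prod_close => //; rewrite normr1.
rewrite -/B -/B0 -/A -/A0.
have -> : A / (2 * b) - A0 / 2 = (A * b^-1 - A0 * 1) / 2 by field; rewrite gt_eqF.
rewrite normrM [`|2^-1|]ger0_norm ?invr_ge0//.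
have : eta * (L2 + 1) * (1 + 2 * eta) <= eta * (L2 + 1) * 2.
  by rewrite ler_wpM2l ?mulr_ge0//; lra.
have p1 : 0 <= eta * L2 by rewrite mulr_ge0// ltW.
have p2 : 0 <= eta * Ab by rewrite mulr_ge0.
by lra.
Qed.

End Discretization.

(** * Absence of a terminal jump in the limit *)

Section TerminalJump.
Context {R : realType} {d} {T : measurableType d} (P : probability T R)
  {d'} {T' : measurableType d'} (P' : probability T' R).

(** If the events were pairwise disjoint, their union would have probability above 1. *)
Lemma pr_overlap (A : nat -> set T) k q : (forall i, measurable (A i)) ->
  (forall i, (i < k)%N -> q <= pr P (A i)) -> 1 < q * k%:R ->
  exists i j, [/\ (i < j)%N, (j < k)%N & A i `&` A j !=set0].
Proof.
move=> mA qA qk; apply: contrapT => H.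
have disj i j : (i < j)%N -> (j < k)%N -> A i `&` A j = set0.
  move=> ij jk; apply/eqP; apply: contrapT => /negP/set0P AB; apply: H.
  by exists i, j.
have tA : trivIset setT (fun i : 'I_k => A i).
  move=> i j _ _ [w [Ai Aj]]; apply/val_inj.
  have [ij|ji|//] := ltngtP i j.
    have := disj i j ij (ltn_ord j); rewrite -subset0 => /(_ w)[]; by split.
  have := disj j i ji (ltn_ord i); rewrite -subset0 => /(_ w)[]; by split.
have mU : measurable (\big[setU/set0]_(i < k) A i) by exact: bigsetU_measurable.
have E : P (\big[setU/set0]_(i < k) A i) = (\sum_(i < k) P (A i))%E.
  exact: (measure_bigsetU_ord P predT (fun i : 'I_k => mA i) tA).
rewrite (EFin_pr P _ mU) (eq_bigr (fun i : 'I_k => (pr P (A i))%:E)) in E; last first.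
  by move=> i _; rewrite (EFin_pr P).
rewrite sumEFin in E; case: E => E.
have : \sum_(i < k) q <= \sum_(i < k) pr P (A i) by apply: ler_sum => i _; exact: qA.
rewrite -E sumr_const card_ord -mulr_natr.
by have := pr_le1 P _ mU; lra.
Qed.

(** One sequence [S] serves all [n]; only norming and time scale change. Hence paths with different
    [n] can be compared at the same sample point. *)
Variables (a : nat -> R) (S : nat -> T -> R) (Z : T' -> R -> R).
Hypothesis a0 : forall n, 0 < a n.
Hypothesis mS : forall k, measurable_fun setT (S k).
Hypothesis DZ : D_random_variable Z.
Let s n k w := (a n)^-1 * S k w.
Let V n w := step_path n (fun k => s n k w).
Hypothesis VZ : cvg_dist_D P V P' Z.
Hypothesis Z0 : P' [set w | forall t, 0 <= t <= 1 -> Z w t = 0] = 0%E.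

Let ms n k : measurable_fun setT (s n k).
Proof. by apply: measurable_funM => //; exact: measurable_cst. Qed.

Let cV n w : cadlag (V n w). Proof. exact: step_path_cadlag. Qed.

Lemma step_path_grid_lt n (u : nat -> R) k : (k < n)%N ->
  step_path n u (k%:R / n%:R) = u k /\ 0 <= (k%:R / n%:R : R) < 1.
Proof.
move=> kn; have n0 : (0 < n)%N by exact: leq_ltn_trans kn.
have n0' : 0 < n%:R :> R by rewrite ltr0n.
split; last by rewrite divr_ge0//= ltr_pdivrMr// mul1r ltr_nat.
by apply: step_path_const => //; rewrite lexx/= ltr_pM2r ?invr_gt0// ltr_nat.
Qed.

Lemma step_path_osup n (u : nat -> R) k : (k < n)%N -> `|u k| <= osup (step_path n u).
Proof.
move=> kn; have [E k1] := step_path_grid_lt n u k kn.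
by rewrite -E; apply: le_osup => //; exact: step_path_cadlag.
Qed.

(* sq_int (OU gam f) = 0 only forces f = 0 on [0,1), so the limit has to be shown
   not to consist of a single jump at time 1. A small value of end_jump c f says
   that f is small on [0,1) while |f 1| is at least about 2c. *)
Definition end_jump (c : R) (f : R -> R) : R := Num.max (osup f) (2 * c - `|f 1|).

Lemma skc_end_jump c : skorokhod_continuous (end_jump c).
Proof.
apply: (skc_comp2 osup (fun f => f 1) (fun p : R * R => Num.max p.1 (2 * c - `|p.2|))).
- move=> p; apply: (@continuous_max R (R * R)%type fst (fun p => 2 * c - `|p.2|)).
    exact: cvg_fst.
  apply: cvgB; first exact: cvg_cst.
  by apply: cvg_norm; exact: cvg_snd.
- exact: skc_osup.
- exact: skc_eval1.
Qed.

(** By (D2) a path vanishing on [[0, 1)] is almost surely nonzero at 1, hence above [2 * c] in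
    absolute value on at least half of the event. [q] and [c] are chosen before [eta]: the paths
    become as flat as desired before time 1 at no cost in probability, which the growth argument
    needs. *)
Lemma end_jump_events : P' [set w | osup (Z w) <= 0] <> 0%E ->
  exists q c, [/\ 0 < q, 0 < c & forall eta, 0 < eta ->
    \forall n \near \oo, q <= pr P [set w | end_jump c (V n w) <= eta]].
Proof.
move=> E0; have mJ := measurable_FZ Z DZ osup skc_osup.
have m1 := measurable_FZ Z DZ (fun f => f 1) skc_eval1.
set E := [set w | osup (Z w) <= 0] in E0.
have mE : measurable E by exact: measurable_le_cst.
have p0 : 0 < pr P' E.
  rewrite lt_neqAle pr_ge0 andbT; apply/eqP => p0; apply: E0.
  by rewrite (EFin_pr P')// -p0.
have p2 : 0 < pr P' E / 2 by lra.
pose F k := E `&` [set w | `|Z w 1| <= k.+1%:R^-1].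
have mF k : measurable (F k).
  by apply: measurableI => //; apply: measurable_le_cst; exact: measurableT_comp.
have [||k Hk] := pr_decr P' F _ mF _ _ p2.
- move=> m n mn w [Ew /= H]; split=> //=; apply: le_trans H _.
  by rewrite lef_pV2 ?posrE// ler_nat.
- apply: (subset_measure0 (B := [set w | forall t, 0 <= t <= 1 -> Z w t = 0])) => //.
  + exact: bigcap_measurableType.
  + exact: measurable_zero_path.
  move=> w H t /andP[t0]; have [Ew _] := H 0%N I.
  have cZ := DZ.1 w.
  rewrite le_eqVlt => /predU1P[->|t1].
    apply/eqP; rewrite -normr_le0 leNgt; apply/negP => Xw.
    have : \forall k \near \oo, k.+1%:R^-1 < `|Z w 1| by exact: near_infty_natSinv_lt (PosNum Xw).
    move=> [k _ /(_ k (leqnn k))/= Hk].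
    by have [_ /=] := H k I; rewrite leNgt Hk.
  apply/eqP; rewrite -normr_le0; apply: le_trans Ew.
  by apply: le_osup => //; rewrite t0.
(* Makes [2 * c] in [end_jump] the threshold [1 / (k + 1)] found above. *)
pose c : R := k.+1%:R^-1 / 2.
have c0 : 0 < c by rewrite divr_gt0// invr_gt0.
exists (pr P' E / 4), c; split=> //; first lra.
move=> eta eta0.
have p4 : 0 < pr P' E / 4 by lra.
have := portmanteau P P' s Z ms DZ VZ _ _ _ _ (skc_end_jump c) eta0 p4.
apply: filterS => n [_]; apply: contraTT; rewrite -!ltNge => H.
have mG := measurable_FZ Z DZ _ (skc_end_jump c).
have : pr P' E <= pr P' (F k) + pr P' [set w | end_jump c (Z w) <= 0].
  apply: le_trans (prU P' _ _ (mF k) (measurable_le_cst _ _ mG)).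
  apply: le_pr => //; first by apply: measurableU => //; exact: measurable_le_cst.
  move=> w Ew; have [h|h] := leP `|Z w 1| k.+1%:R^-1; first by left.
  right; rewrite /= /end_jump ge_max; apply/andP; split => //.
  by rewrite /c mulrC divfK// subr_le0 ltW.
have mEq : [set w | end_jump c (V n w) <= eta] = [set w | end_jump c (step_path n (s n ^~ w)) <= eta] by [].
by move: H; rewrite mEq; lra.
Qed.

Let end_jumpP c n w eta : end_jump c (V n w) <= eta ->
  osup (V n w) <= eta /\ 2 * c - eta <= `|V n w 1|.
Proof. by rewrite /end_jump ge_max => /andP[-> h]; split=> //; lra. Qed.

Let meas_end_jump c n eta : measurable [set w | end_jump c (V n w) <= eta].
Proof.
by apply: measurable_le_cst; apply: measurable_step_path => //; exact: skc_end_jump.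
Qed.

(** On the event the path is at most [c / 2] at [(n - 1) / n] and at least [3 * c / 2] at 1, in
    absolute value. The last increment is then at least [c * a n], which confines an event of
    probability at least [q] to a set of probability at most [q / 2]. *)
Lemma no_end_jump_small_increment :
  (forall e, 0 < e -> \forall n \near \oo, exists2 B, measurable B & pr P B <= e /\
     forall w, ~ B w -> `|S n w - S n.-1 w| <= e * a n) ->
  P' [set w | osup (Z w) <= 0] = 0%E.
Proof.
move=> small; apply: contrapT => /end_jump_events[q [c [q0 c0 H]]].
pose e := Num.min (q / 2) (c / 2).
have e0 : 0 < e by rewrite lt_min !divr_gt0.
have ec : e <= c / 2 by rewrite ge_min lexx orbT.
have eq : e <= q / 2 by rewrite ge_min lexx.
have c2 : 0 < c / 2 by lra.
have [n [n0 [qn [B mB [Be HB]]]]] : exists n, (0 < n)%N /\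
    q <= pr P [set w | end_jump c (V n w) <= c / 2] /\
    exists2 B, measurable B & pr P B <= e /\
     forall w, ~ B w -> `|S n w - S n.-1 w| <= e * a n.
  have : \forall n \near \oo, (0 < n)%N /\
    q <= pr P [set w | end_jump c (V n w) <= c / 2] /\
    exists2 B, measurable B & pr P B <= e /\
     forall w, ~ B w -> `|S n w - S n.-1 w| <= e * a n.
    near=> n; split; first by near: n; exact: nbhs_infty_gt.
    by split; near: n; [exact: H|exact: small].
  by move=> [n _ /(_ n (leqnn n))]; exists n.
have : [set w | end_jump c (V n w) <= c / 2] `<=` B.
  move=> w /= /end_jumpP[J1 J2]; apply: contrapT => /HB.
  have := step_path_osup n (s n ^~ w) n.-1; rewrite prednK// leqnn => /(_ isT) J3.
  have J3' := le_trans J3 J1.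
  move: J2; rewrite /V step_path1 => J2.
  have an := a0 n.
  have -> : S n w - S n.-1 w = (s n n w - s n n.-1 w) * a n.
    by rewrite /s; field; rewrite gt_eqF.
  rewrite normrM (gtr0_norm an) ler_pM2r//.
  by have := lerB_dist (s n n w) (s n n.-1 w); lra.
by move=> /(le_pr P _ _ (meas_end_jump _ _ _) mB); lra.
Unshelve. all: by end_near. Qed.

(* If terminal jumps kept a positive probability, then among boundedly many
   consecutive indices two such events would meet, and the larger of the two
   indices would have a much larger norming constant: a would grow exponentially. *)
Lemma no_end_jump_poly_growth (C : R) :
  (\forall n \near \oo, a n <= C * n%:R) ->
  P' [set w | osup (Z w) <= 0] = 0%E.
Proof.
move=> poly; apply: contrapT => /end_jump_events[q [c [q0 c0 H]]].
pose tot (f : R -> R) := Num.max (osup f) `|f 1|.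
have ctot : skorokhod_continuous tot.
  apply: (skc_comp2 osup (fun f => f 1) (fun p : R * R => Num.max p.1 `|p.2|)).
  - move=> p; apply: (@continuous_max R (R * R)%type fst (fun p => `|p.2|)).
      exact: cvg_fst.
    by apply: cvg_norm; exact: cvg_snd.
  - exact: skc_osup.
  - exact: skc_eval1.
have q2 : 0 < q / 2 by lra.
have [K K0 HK] := tight_skc P P' s Z ms DZ VZ _ _ ctot q2.
pose k := (Num.truncn (q^-1)).+1.
have qk : 1 < q * k%:R by rewrite -ltr_pdivrMl// mulr1 truncnS_gt.
pose D := K / c.
have D0 : 0 < D by rewrite divr_gt0.
(* The factor [D] is lost twice, from [n] to [n + i] and from [n + j] to [n + k]; this choice still
   leaves [2 * a n <= a (n + k)]. *)
pose eta := c / (2 * D ^+ 2).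
have eta0 : 0 < eta by rewrite divr_gt0// mulr_gt0// exprn_gt0.
have [N HN] : exists N, forall n, (N <= n)%N -> [/\ (0 < n)%N, a n <= C * n%:R,
    q <= pr P [set w | end_jump c (V n w) <= c],
    q <= pr P [set w | end_jump c (V n w) <= eta] &
    pr P [set w | K <= tot (V n w)] <= q / 2].
  have : \forall n \near \oo, [/\ (0 < n)%N, a n <= C * n%:R,
    q <= pr P [set w | end_jump c (V n w) <= c],
    q <= pr P [set w | end_jump c (V n w) <= eta] &
    pr P [set w | K <= tot (V n w)] <= q / 2].
    near=> n; split; near: n.
    - exact: nbhs_infty_gt.
    - exact: poly.
    - exact: H.
    - exact: H.
    - exact: HK.
  by move=> [N _ HN]; exists N.
(* [a] is increasing up to the factor [D]: an event of probability at least [q] leaves one of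
   probability at most [q / 2], and at such a point [c * a m <= |S m| <= K * a n]. *)
have mono m n : (N <= m)%N -> (m <= n)%N -> a m <= D * a n.
  move=> Nm mn; have [_ _ q1 _ _] := HN m Nm.
  have [_ _ _ _ q3] := HN n (leq_trans Nm mn).
  have mtot : measurable [set w | K <= tot (V n w)].
    by apply: measurable_ge_cst; exact: measurable_step_path.
  have [w [/end_jumpP[_ w1] w2]] : exists w, end_jump c (V m w) <= c /\ ~ K <= tot (V n w).
    apply: contrapT => /forallNP Hw.
    have : [set w | end_jump c (V m w) <= c] `<=` [set w | K <= tot (V n w)].
      by move=> w /= h; have := Hw w; case/not_andP => // /contrapT.
    by move=> /(le_pr P _ _ (meas_end_jump _ _ _) mtot); lra.
  have am := a0 m; have an := a0 n.
  have h1 : c * a m <= `|S m w|.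
    move: w1; rewrite /V step_path1 /s normrM gtr0_norm ?invr_gt0//.
    by rewrite ler_pdivlMl//; lra.
  have h2 : `|S m w| <= K * a n.
    move/negP: w2; rewrite -ltNge /tot gt_max => /andP[t1 t2].
    have h : `|s n m w| <= K.
      move: mn; rewrite leq_eqVlt => /predU1P[->|mn].
        by move: t2; rewrite /V step_path1 => /ltW.
      exact: le_trans (step_path_osup n (s n ^~ w) m mn) (ltW t1).
    by move: h; rewrite /s normrM gtr0_norm ?invr_gt0// ler_pdivrMl// mulrC.
  by rewrite /D mulrAC ler_pdivlMr//; lra.
have D1 : 1 <= D by have := mono N N (leqnn _) (leqnn _); rewrite -ler_pdivrMr// divff// gt_eqF.
have etac : eta <= c.
  rewrite /eta ler_pdivrMr; last by rewrite mulr_gt0// exprn_gt0.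
  have D2 : 1 <= D ^+ 2 by rewrite exprn_ege1.
  by have := ler_wpM2l (ltW c0) D2; lra.
(* On the overlap [S (n + i)] is the terminal value of one path, so at least [c * a (n + i)] in
   size, and an earlier value of the other, so at most [eta * a (n + j)]. *)
have double n : (N <= n)%N -> 2 * a n <= a (n + k)%N.
  move=> Nn.
  have qA i : (i < k)%N -> q <= pr P [set w | end_jump c (V (n + i) w) <= eta].
    by move=> _; have [] := HN (n + i)%N (leq_trans Nn (leq_addr _ _)).
  have [i [j [ij jk [w [/= /end_jumpP[_ wi] /end_jumpP[wj _]]]]]] := pr_overlap
     (fun i => [set w | end_jump c (V (n + i) w) <= eta]) k q
     (fun i => meas_end_jump _ _ _) qA qk.
  have ai := a0 (n + i); have aj := a0 (n + j).
  have h1 : c * a (n + i)%N <= `|S (n + i)%N w|.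
    move: wi; rewrite /V step_path1 /s normrM gtr0_norm ?invr_gt0//.
    rewrite ler_pdivlMl//.
    have : a (n + i)%N * c <= a (n + i)%N * (2 * c - eta) by rewrite ler_pM2l//; lra.
    by lra.
  have h2 : `|S (n + i)%N w| <= eta * a (n + j)%N.
    have nij : (n + i < n + j)%N by rewrite ltn_add2l.
    have := le_trans (step_path_osup (n + j) (s (n + j) ^~ w) (n + i) nij) wj.
    by rewrite /s normrM gtr0_norm ?invr_gt0// ler_pdivrMl// mulrC.
  have h3 : a n <= D * a (n + i)%N by apply: mono => //; exact: leq_addr.
  have h4 : a (n + j)%N <= D * a (n + k)%N.
    by apply: mono; [exact: leq_trans (leq_addr _ _)|rewrite leq_add2l ltnW].
  have h5 : c * a n <= D * (eta * a (n + j)%N).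
    apply: (@le_trans _ _ (c * (D * a (n + i)%N))); first by rewrite ler_pM2l.
    by rewrite mulrCA ler_pM2l// (le_trans h1).
  have h6 : D * (eta * a (n + j)%N) <= D * (eta * (D * a (n + k)%N)).
    by rewrite !ler_pM2l.
  have h7 : D * (eta * (D * a (n + k)%N)) = c * (a (n + k)%N / 2).
    by rewrite /eta; field; rewrite gt_eqF.
  by have := le_trans h5 h6; rewrite h7 ler_pM2l//; lra.
have grow j : 2 ^+ j * a N <= a (N + j * k)%N.
  elim: j => [|j IH]; first by rewrite expr0 mul1r mul0n addn0.
  rewrite exprS -mulrA mulSn addnCA addnC.
  by apply: le_trans (double _ (leq_addr _ _)); rewrite ler_pM2l.
have aN := a0 N.
(* With [2 * i] doublings, one factor [2 ^ i >= i + 1] beats the linear growth in [i] and the other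
   the initial ratio. *)
pose i := Num.truncn (`|C| * (N%:R + 2 * k%:R) / a N).
have hi : `|C| * (N%:R + 2 * k%:R) < i.+1%:R * a N.
  by rewrite -ltr_pdivrMr// truncnS_gt.
have [_ hC _ _ _] := HN (N + (2 * i) * k)%N (leq_addr _ _).
have := le_trans (grow (2 * i)%N) hC.
have h2i : i.+1%:R <= 2 ^+ i :> R by rewrite -natrX ler_nat ltn_expl.
have h4i : i.+1%:R * i.+1%:R <= 2 ^+ (2 * i) :> R.
  by rewrite mul2n -addnn exprD ler_pM.
have h5 : i.+1%:R * i.+1%:R * a N <= 2 ^+ (2 * i) * a N by rewrite ler_pM2r.
apply/negP; rewrite -ltNge; apply: lt_le_trans h5.
have h6 : (N + 2 * i * k)%:R <= i.+1%:R * (N%:R + 2 * k%:R) :> R.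
  by rewrite natrD !natrM -natr1; have := ler0n R N; have := ler0n R i; have := ler0n R k; nra.
apply: (@le_lt_trans _ _ (`|C| * (i.+1%:R * (N%:R + 2 * k%:R)))).
  apply: (@le_trans _ _ (`|C| * (N + 2 * i * k)%:R)).
    by rewrite ler_wpM2r// ler_norm.
  by rewrite ler_wpM2l.
by rewrite mulrCA -mulrA ltr_pM2l// ltr0n.
Unshelve. all: by end_near. Qed.

End TerminalJump.

(** * Limit of the regression statistics *)

Section WeakLimit.
Context {R : realType}.

(** Only [p] is confined to the box: it will come from a bounded path, while [q] is the nearby pair
    computed from the model. *)
Lemma uniform_continuity_box (h : R * R -> R) K e : continuous h -> 0 < e ->
  exists2 del, 0 < del & forall p q : R * R, `|p.1| <= K -> `|p.2| <= K ->
    `|p.1 - q.1| < del -> `|p.2 - q.2| < del -> `|h p - h q| < e.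
Proof.
move=> ch e0.
have cK : compact (`[- K, K] `*` `[- K, K] : set (R * R)).
  by apply: compact_setX; exact: segment_compact.
move: cK; rewrite compact_near_coveringP => cK.
have e2 : 0 < e / 2 by lra.
have := cK R (0 : R)^'+ (fun del p => forall q : R * R,
   `|p.1 - q.1| < del -> `|p.2 - q.2| < del -> `|h p - h q| < e) _.
case.
- move=> x _; have /cvgrPdist_lt/(_ _ e2)/nbhs_ballP[r /= r0 Hr] := ch x.
  exists (ball x (r / 2), [set del | 0 < del < r / 2]).
    split=> /=; first by apply: nbhsx_ballx; lra.
    near=> t; apply/andP; split; near: t; first exact: nbhs_right_gt.
    by apply: nbhs_right_lt; lra.
  move=> [p del] /= [[/= p1 p2] /andP[del0 delr]] q q1 q2.
  have hp : `|h x - h p| < e / 2.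
    by apply: Hr; split; rewrite /ball/=; [move: p1|move: p2]; rewrite /ball/=; lra.
  have hq : `|h x - h q| < e / 2.
    apply: Hr; split; rewrite /ball/=.
    - by have := ler_distD p.1 x.1 q.1; move: p1; rewrite /ball/=; lra.
    - by have := ler_distD p.2 x.2 q.2; move: p2; rewrite /ball/=; lra.
  have -> : h p - h q = (h x - h q) - (h x - h p) by ring.
  by rewrite (le_lt_trans (ler_normB _ _))//; lra.
- move=> r /= r0 Hr; exists (r / 2); first by lra.
  move=> p q p1 p2; apply: Hr => /=.
  + by rewrite sub0r normrN gtr0_norm; lra.
  + by lra.
  + by split=> /=; rewrite in_itv/= -ler_norml.
Unshelve. all: by end_near. Qed.

Lemma continuous_pair (U : topologicalType) (f g : U -> R) :
  continuous f -> continuous g -> continuous (fun x => (f x, g x)).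
Proof. by move=> cf cg x; exact: (cvg_pair (cf x) (cg x)). Qed.

(** The continuous maps [x / (x^2 + 1/(k+1))] converge to the inverse everywhere, including 0, where
    the inverse is 0 by convention. *)
Lemma measurable_inv d (T : measurableType d) (f : T -> R) :
  measurable_fun setT f -> measurable_fun setT (fun w => (f w)^-1).
Proof.
move=> mf; pose g k (x : R) := x / (x ^+ 2 + k.+1%:R^-1).
have i0 k : 0 < k.+1%:R^-1 :> R by rewrite invr_gt0.
have den0 k (x : R) : 0 < x ^+ 2 + k.+1%:R^-1 by rewrite ltr_wpDl// sqr_ge0.
have cg k : continuous (g k).
  move=> x; apply: cvgM; first exact: cvg_id.
  apply: cvgV; first by rewrite gt_eqF.
  by apply: cvgD; [exact: exprn_continuous|exact: cvg_cst].
apply: (@measurable_fun_cvg _ _ R _ (fun k => g k \o f)).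
  by move=> k; apply: measurableT_comp => //; exact: continuous_measurable_fun.
move=> w _; have [fw|fw] := eqVneq (f w) 0.
  by rewrite fw invr0; apply: cvg_near_cst; near=> k; rewrite /= fw /g mul0r.
have -> : (f w)^-1 = f w / (f w ^+ 2 + 0) by rewrite addr0; field.
apply: cvgM; first exact: cvg_cst.
apply: cvgV; first by rewrite addr0 expf_neq0.
by apply: cvgD; [exact: cvg_cst|exact: cvg_harmonic].
Unshelve. all: by end_near. Qed.

End WeakLimit.

(** * One limit theorem behind the three cases *)

Section Regression.
Context {R : realType} {d} {T : measurableType d} (P : probability T R)
  {d'} {T' : measurableType d'} (P' : probability T' R).
Variables (a beta : nat -> R) (gam : R) (eps X0 : nat -> T -> R) (Z : T' -> R -> R).
Hypothesis a0 : forall n, 0 < a n.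
Hypothesis hbeta : (n%:R * (1 - beta n)) @[n --> \oo] --> gam.
Hypothesis meps : forall k, measurable_fun setT (eps k).
Hypothesis mX0 : forall n, measurable_fun setT (X0 n).
Hypothesis hX0 : small_oP P X0 a.

Let S k w : R := \sum_(1 <= i < k.+1) eps i w.
Let s n k w : R := (a n)^-1 * S k w.
Let V n w := step_path n (fun k => s n k w).
Let X n w t : R := Xn beta X0 eps n w t.

Lemma measurable_partial_sum k : measurable_fun setT (S k).
Proof. exact: measurable_sum. Qed.

Let ms n k : measurable_fun setT (s n k).
Proof.
by apply: measurable_funM; [exact: measurable_cst|exact: measurable_partial_sum].
Qed.

Lemma measurable_Xn n t : measurable_fun setT (fun w => X n w t).
Proof.
elim: t => [|t IH]; first exact: mX0.
apply: measurable_funD; last exact: meps.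
by apply: measurable_funM => //; exact: measurable_cst.
Qed.

Lemma measurable_bhat n : measurable_fun setT (bhat beta X0 eps n).
Proof.
apply: measurable_funM.
  apply: measurable_sum => t; apply: measurable_funM.
    exact: (measurable_Xn n t.+1).
  exact: (measurable_Xn n t).
apply: measurable_inv; apply: measurable_sum => t.
by apply: measurable_funX; exact: (measurable_Xn n t).
Qed.

Lemma measurable_tauhat n : measurable_fun setT (tauhat beta X0 eps n).
Proof.
apply: measurable_funM; last first.
  by apply: measurable_funB; [exact: measurable_bhat|exact: measurable_cst].
apply: measurableT_comp.
  by apply: continuous_measurable_fun; exact: sqrt_continuous.
by apply: measurable_sum => t; apply: measurable_funX; exact: (measurable_Xn n t).
Qed.

Lemma beta_cvg1 : beta n @[n --> \oo] --> (1 : R).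
Proof.
have h : (1 - n.+1%:R^-1 * (n.+1%:R * (1 - beta n.+1))) @[n --> \oo] --> 1 - 0 * gam.
  apply: cvgB; first exact: cvg_cst.
  apply: cvgM; first exact: cvg_harmonic.
  by have := hbeta; rewrite -(cvg_shiftS (fun n => n%:R * (1 - beta n))).
rewrite mul0r subr0 in h; rewrite -(cvg_shiftS beta).
apply: cvg_trans h; apply: near_eq_cvg; near=> n => /=.
by rewrite mulrA mulVf// mul1r; ring.
Unshelve. all: by end_near. Qed.

Lemma beta_sq_cvg : n%:R * (1 - beta n ^+ 2) @[n --> \oo] --> 2 * gam.
Proof.
have -> : (fun n => n%:R * (1 - beta n ^+ 2)) =
    (fun n => (1 + beta n) * (n%:R * (1 - beta n))).
  by apply/funext => n; ring.
have -> : 2 = 1 + 1 :> R by [].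
apply: cvgM => //; apply: cvgD; [exact: cvg_cst|exact: beta_cvg1].
Qed.

(** [m] norms the numerator and [p] corrects the denominator. Case (i): [m = a^-2], [p = 1],
    [rho = 1], [kap = 0]. Case (ii): [m = 1/n], [p = a^2/n], [rho = 1], [kap = sigma2]. Case (iii):
    [m = 1/n], [p = 1], [rho = 0], [kap = sigma2]. *)
Variables (m p : nat -> R) (rho kap : R).
Hypothesis hrho : m n * a n ^+ 2 @[n --> \oo] --> rho.
Hypothesis hp : p n @[n --> \oo] --> (1 : R).
Let W n w : R := m n * \sum_(1 <= k < n.+1) eps k w ^+ 2 - kap.
Hypothesis hW : small_oP P W (fun=> 1).

Let num n w : R := m n *
  (\sum_(t < n) X n w t.+1 * X n w t - beta n * \sum_(t < n) X n w t ^+ 2).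
Let den n w : R := p n * (n%:R^-1 * \sum_(t < n) (X n w t / a n) ^+ 2).
Let quad (q : R * R) : R := (rho * (q.1 ^+ 2 + 2 * gam * q.2) - kap) / 2.

(** The index [n] is read only at time 1, which [osup] omits; hence the second hypothesis. *)
Lemma step_path_le n (u : nat -> R) M : osup (step_path n u) <= M ->
  `|step_path n u 1| <= M -> forall k, (k <= n)%N -> `|u k| <= M.
Proof.
move=> uM u1 k; rewrite leq_eqVlt => /predU1P[->|kn].
  by rewrite -(step_path1 n u).
exact: le_trans (step_path_osup n u k kn) uM.
Qed.

Lemma S_increment n t w : s n t.+1 w - s n t w = (a n)^-1 * eps t.+1 w.
Proof. by rewrite /s /S -mulrBr big_nat_recr//= addrAC subrr add0r. Qed.

Lemma numE n w : (0 < n)%N -> beta n != 0 ->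
  num n w = ((m n * a n ^+ 2) * ((X n w n / a n) ^+ 2 - (X0 n w / a n) ^+ 2 +
     n%:R * (1 - beta n ^+ 2) * (n%:R^-1 * \sum_(t < n) (X n w t / a n) ^+ 2)) -
     m n * \sum_(1 <= k < n.+1) eps k w ^+ 2) / (2 * beta n).
Proof.
move=> n0 b0; have n0' : n%:R != 0 :> R by rewrite pnatr_eq0 -lt0n.
have an : a n != 0 by rewrite gt_eqF.
have rec t : (t < n)%N -> X n w t.+1 / a n = beta n * (X n w t / a n) +
    (a n)^-1 * eps t.+1 w.
  by move=> _; rewrite /X /Xn /=; field.
have := ar_square_identity (fun t => X n w t / a n) (beta n) (fun t => (a n)^-1 * eps t.+1 w) n rec.
have -> : \sum_(t < n) X n w t.+1 / a n * (X n w t / a n) =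
    (a n ^+ 2)^-1 * \sum_(t < n) X n w t.+1 * X n w t.
  by rewrite mulr_sumr; apply: eq_bigr => t _; field.
have -> : \sum_(t < n) ((a n)^-1 * eps t.+1 w) ^+ 2 =
    (a n ^+ 2)^-1 * \sum_(1 <= k < n.+1) eps k w ^+ 2.
  rewrite big_add1 big_mkord mulr_sumr; apply: eq_bigr => t _; field => //.
have HQ : \sum_(t < n) X n w t ^+ 2 = a n ^+ 2 * \sum_(t < n) (X n w t / a n) ^+ 2.
  by rewrite mulr_sumr; apply: eq_bigr => t _; field.
rewrite /num HQ -[X n w 0%N]/(X0 n w).
set A := \sum_(t < n) _ * _; set Q := \sum_(t < n) _; set E := \sum_(1 <= k < n.+1) _.
move=> I.
have -> : m n * (A - beta n * (a n ^+ 2 * Q)) = (m n * a n ^+ 2) *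
   (2 * beta n * ((a n ^+ 2)^-1 * A - beta n * Q)) / (2 * beta n).
  by field; rewrite an b0.
rewrite I; field; rewrite an b0 n0'//.
Qed.

Lemma regression_close M e : 0 <= M -> 0 < e -> exists2 eta, 0 < eta &
  \forall n \near \oo, forall w, osup (V n w) <= M -> `|V n w 1| <= M ->
    `|X0 n w| <= eta * a n -> `|W n w| <= eta ->
    `|quad (OU gam (V n w) 1, sq_int (OU gam (V n w))) - num n w| <= e /\
    `|sq_int (OU gam (V n w)) - den n w| <= e.
Proof.
move=> M0 e0; pose K := (1 + `|gam| * expR `|gam|) * M.
have K0 : 0 <= K by rewrite mulr_ge0// addr_ge0// mulr_ge0// expR_ge0.
have [L L0 HL] := quad_close K kap rho gam K0.
have K2 : 0 < K ^+ 2 + 2 by rewrite ltr_wpDl// sqr_ge0.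
(* The three bounds serve, in order, the invertibility of [beta n], the error of the numerator and
   that of the denominator. *)
pose e1 := Num.min 2^-1 (Num.min (e / L) (e / (K ^+ 2 + 2))).
have e10 : 0 < e1 by rewrite !lt_min invr_gt0 ltr0n /= !divr_gt0.
have e12 : e1 <= 2^-1 by rewrite ge_min lexx.
have e1L : e1 * L <= e by rewrite -ler_pdivlMr// !ge_min lexx !orbT.
have e1K : e1 * (K ^+ 2 + 2) <= e by rewrite -ler_pdivlMr// !ge_min lexx !orbT.
have [eta1 eta10 Har] := ar_functionals_close beta gam hbeta M e1 M0 e10.
exists (Num.min eta1 e1); first by rewrite lt_min eta10 e10.
near=> n => w oM V1 hx0 hw.
have n0 : (0 < n)%N by near: n; exact: nbhs_infty_gt.
have h1 : `|rho - m n * a n ^+ 2| <= e1.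
  by near: n; move/cvgrPdist_le: hrho; exact.
have h2 : `|1 - p n| <= e1 by near: n; move/cvgrPdist_le: hp; exact.
have h3 : `|1 - beta n| <= e1 by near: n; move/cvgrPdist_le: beta_cvg1; exact.
have h4 : `|2 * gam - n%:R * (1 - beta n ^+ 2)| <= e1.
  by near: n; move/cvgrPdist_le: beta_sq_cvg; exact.
have an := a0 n.
have sM : forall k, (k <= n)%N -> `|s n k w| <= M by exact: step_path_le.
have x0e : `|X0 n w / a n| <= Num.min eta1 e1.
  by rewrite normrM normfV (gtr0_norm an) ler_pdivrMr.
have [x01 x02] : `|X0 n w / a n| <= eta1 /\ `|X0 n w / a n| <= e1.
  by move: x0e; rewrite le_min => /andP[].
have s0 : s n 0%N w = 0 by rewrite /s /S big_nil mulr0.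
have rec t : (t < n)%N -> X n w t.+1 / a n = beta n * (X n w t / a n) +
    (s n t.+1 w - s n t w).
  by move=> _; rewrite S_increment /X /Xn /=; field; rewrite gt_eqF.
have [c1 c2] : `|X n w n / a n - OU gam (V n w) 1| <= e1 /\
    `|n%:R^-1 * (\sum_(t < n) (X n w t / a n) ^+ 2) - sq_int (OU gam (V n w))| <= e1.
  have HA : forall s x, s 0%N = 0 ->
    (forall k, (k <= n)%N -> `|s k| <= M) -> `|x 0%N| <= eta1 ->
    (forall t, (t < n)%N -> x t.+1 = beta n * x t + (s t.+1 - s t)) ->
    `|x n - OU gam (step_path n s) 1| <= e1 /\
    `|n%:R^-1 * (\sum_(t < n) x t ^+ 2) - sq_int (OU gam (step_path n s))| <= e1.
    by near: n.
  exact: (HA (fun k => s n k w) (fun t => X n w t / a n)).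
have bV : bdm (V n w) by apply: cadlag_bdm; exact: step_path_cadlag.
have VM t : 0 <= t < 1 -> `|V n w t| <= M.
  by move=> t01; apply: le_trans oM; apply: le_osup => //; exact: step_path_cadlag.
have OK t : 0 <= t <= 1 -> `|OU gam (V n w) t| <= K.
  move=> t01; apply: OU_bound => //; case/andP: (t01) => t0.
  by rewrite le_eqVlt => /predU1P[->//|t1]; apply: VM; rewrite t0.
have G1K : `|OU gam (V n w) 1| <= K by apply: OK; rewrite ler01 lexx.
have G2K : `|sq_int (OU gam (V n w))| <= K ^+ 2.
  rewrite ger0_norm ?sq_int_ge0//; apply: sq_int_le => //.
    by apply: cadlag_bdm; apply: OU_cadlag; exact: step_path_cadlag.
  by move=> t /andP[t0 t1]; apply: OK; rewrite t0 ltW.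
have b0 : beta n != 0.
  by rewrite gt_eqF//; move: h3; rewrite ler_distl => /andP[]; lra.
have wk : `|m n * (\sum_(1 <= k < n.+1) eps k w ^+ 2) - kap| <= e1.
  by move: hw; rewrite le_min => /andP[].
split.
  rewrite distrC numE// /quad; apply: le_trans e1L; apply: HL => //; by rewrite distrC.
rewrite distrC /den; set Q := _^-1 * _ in c2 *; set G := sq_int _ in c2 G2K *.
have -> : p n * Q - G = (Q - G) - (1 - p n) * (G + (Q - G)) by ring.
rewrite (le_trans (ler_normB _ _))// normrM.
have hQ : `|G + (Q - G)| <= K ^+ 2 + 1.
  by rewrite (le_trans (ler_normD _ _))//; lra.
have : `|1 - p n| * `|G + (Q - G)| <= e1 * (K ^+ 2 + 1) by rewrite ler_pM.
by lra.
Unshelve. all: by end_near. Qed.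

Hypothesis DZ : D_random_variable Z.
Hypothesis VZ : cvg_dist_D P (partial_sum_process a eps) P' Z.
Hypothesis J0 : P' [set w | osup (Z w) <= 0] = 0%E.

Let G f : R * R := (OU gam f 1, sq_int (OU gam f)).

Lemma sq_int_OU_gt0 : P' [set w | sq_int (OU gam (Z w)) <= 0] = 0%E.
Proof.
apply: (subset_measure0 (B := [set w | osup (Z w) <= 0])) => //.
- apply: measurable_le_cst.
  exact: (measurable_FZ Z DZ _ (skc_sq_int_OU gam)).
- apply: measurable_le_cst; exact: (measurable_FZ Z DZ _ skc_osup).
move=> w /= Gw; have cZ := DZ.1 w.
have G0 : sq_int (OU gam (Z w)) = 0 by apply/le_anti; rewrite Gw sq_int_ge0.
have O0 := sq_int_eq0 _ (OU_cadlag gam _ cZ) G0.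
by apply: osup_le => t t01; rewrite (OU_eq0 gam _ cZ O0)// normr0.
Qed.

(* (x, y) |-> (x / sqrt y, x / y), made continuous by truncating y at del *)
Let ratio (del : R) (q : R * R) : R * R :=
  (q.1 / Num.sqrt (Num.max q.2 del), q.1 / Num.max q.2 del).

Lemma continuous_ratio del : 0 < del -> continuous (ratio del).
Proof.
move=> del0; have mx0 q : 0 < Num.max q del by rewrite lt_max del0 orbT.
have cm (q : R * R) : {for q, continuous (fun q : R * R => Num.max q.2 del)}.
  apply: (@continuous_max R (R * R)%type snd (fun=> del)); first exact: cvg_snd.
  exact: cvg_cst.
apply: continuous_pair => q; apply: cvgM; try exact: cvg_fst.
  apply: cvgV; first by rewrite gt_eqF// sqrtr_gt0.
  exact: (continuous_comp (cm q) (@sqrt_continuous R _)).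
by apply: cvgV; [rewrite gt_eqF|exact: cm].
Qed.

Lemma continuous_quad : continuous quad.
Proof.
move=> q; rewrite /quad; apply: cvgM; last exact: cvg_cst.
apply: cvgB; last exact: cvg_cst.
apply: cvgM; first exact: cvg_cst.
apply: cvgD; first by apply: cvgM; exact: cvg_fst.
by apply: cvgM; [exact: cvg_cst|exact: cvg_snd].
Qed.

Lemma small_oP_pr (U : nat -> T -> R) (c : nat -> R) eta e : small_oP P U c ->
  0 < eta -> 0 < e -> \forall n \near \oo, pr P [set w | eta * c n < `|U n w|] <= e.
Proof.
move=> hU eta0 e0; have /fine_cvg/cvgrPdist_le/(_ e e0) := hU eta eta0.
by apply: filterS => n /=; rewrite sub0r normrN ger0_norm// pr_ge0.
Qed.

Lemma measurable_gt_norm (U : T -> R) b : measurable_fun setT U ->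
  measurable [set w | b < `|U w|].
Proof.
move=> mU; rewrite (_ : [set _ | _] = ~` [set w | `|U w| <= b]).
  by apply: measurableC; apply: measurable_le_cst; exact: measurableT_comp.
by apply/seteqP; split=> w /=; rewrite ltNge => /negP.
Qed.

(** Three exchanges: the statistic for the truncated functional of [V_n], [V_n] for [Z] by weak
    convergence, the truncated quotient of [Z] for the true one. Agreement of [Y1], [Y2] with the
    quotients is required only where [den] is positive, which has probability near 1 for large
    [n]. *)
Theorem regression_limit (Y1 Y2 : nat -> T -> R) :
  (forall n, measurable_fun setT (Y1 n)) -> (forall n, measurable_fun setT (Y2 n)) ->
  (\forall n \near \oo, forall w, 0 < den n w ->
     Y1 n w = num n w / Num.sqrt (den n w) /\ Y2 n w = num n w / den n w) ->
  cvg_dist_R2 P (fun n w => (Y1 n w, Y2 n w)) P'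
    (fun w => scaleR2 (quad (G (Z w))) (Theta (OU gam (Z w)))).
Proof.
move=> mY1 mY2 hY F cF [M FM].
have cG1 := @skc_OU1 R gam; have cG2 := @skc_sq_int_OU R gam.
have M0 : 0 <= M by apply: le_trans (FM (0, 0)).
have mZ1 := measurable_FZ Z DZ _ cG1.
have mZ2 := measurable_FZ Z DZ _ cG2.
have mq : measurable_fun setT (fun w => quad (G (Z w))).
  by apply: (measurable_continuous2 quad) => //; exact: continuous_quad.
have mlim : measurable_fun setT
    (fun w => F (scaleR2 (quad (G (Z w))) (Theta (OU gam (Z w))))).
  apply: (measurable_continuous2 F) => //.
    apply: measurable_funM => //; apply: measurable_inv.
    apply: measurableT_comp => //.
    by apply: continuous_measurable_fun; exact: sqrt_continuous.
  by apply: measurable_funM => //; exact: measurable_inv.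
have mFY n : measurable_fun setT (fun w => F (Y1 n w, Y2 n w)).
  exact: measurable_continuous2.
apply/(cvg_mean P P' _ _ M) => //.
apply/cvgrPdist_le => e e0.
(* Budget: [e1 + 10 * M * e1] for the first exchange, [e1] for the second, [2 * M * e1] for the
   third. *)
pose e1 := e / (2 + 12 * M).
have den0 : 0 < 2 + 12 * M by lra.
have e10 : 0 < e1 by rewrite divr_gt0.
have e1E : e1 * (2 + 12 * M) = e by rewrite divfK// gt_eqF.
have [del3 del30 Hdel] := pr_small P' _ _ mZ2 sq_int_OU_gt0 e10.
(* [2 * del < del3] leaves room for the portmanteau inequality, and an error of at most [del] then
   keeps [den] above [del], where the truncation is inactive. *)
pose del := del3 / 3.
have del0 : 0 < del by rewrite divr_gt0.
pose h0 (q : R * R) := F (ratio del q).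
have ch0 : continuous h0.
  by move=> q; apply: (continuous_comp (f := ratio del) (g := F)); [exact: continuous_ratio|exact: cF].
pose h (q : R * R) := h0 (quad q, q.2).
have ch : continuous h.
  move=> q; apply: (continuous_comp (f := fun q => (quad q, q.2)) (g := h0)); last exact: ch0.
  by apply: continuous_pair; [exact: continuous_quad|move=> ?; exact: cvg_snd].
have ck : skorokhod_continuous (fun f => h (OU gam f 1, sq_int (OU gam f))).
  exact: skc_comp2.
have hM f : `|h (OU gam f 1, sq_int (OU gam f))| <= M by exact: FM.
have step2 : \forall n \near \oo, `|mean P' (fun w => h (G (Z w))) -
    mean P (fun w => h (G (V n w)))| <= e1.
  by have /cvgrPdist_le/(_ _ e10) := cvg_mean_skc P P' s Z ms DZ VZ _ M ck hM.
have step3 : `|mean P' (fun w => h (G (Z w))) -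
    mean P' (fun w => F (scaleR2 (quad (G (Z w))) (Theta (OU gam (Z w)))))| <=
    0 + 2 * M * pr P' [set w | sq_int (OU gam (Z w)) <= del3].
  apply: mean_close => //.
  - exact: (measurable_FZ Z DZ _ ck).
  - by move=> w; exact: FM.
  - exact: measurable_le_cst.
  move=> w /= /negP; rewrite -ltNge => Gd.
  rewrite [h _](_ : _ = F (scaleR2 (quad (G (Z w))) (Theta (OU gam (Z w))))).
    by rewrite subrr normr0.
  by rewrite /h /h0 /ratio/= max_l// /del; lra.
pose tot (f : R -> R) := Num.max (osup f) `|f 1|.
have ctot : skorokhod_continuous tot.
  apply: (skc_comp2 osup (fun f => f 1) (fun q : R * R => Num.max q.1 `|q.2|)).
  - move=> q; apply: (@continuous_max R (R * R)%type fst (fun q => `|q.2|)).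
      exact: cvg_fst.
    by apply: cvg_norm; exact: cvg_snd.
  - exact: skc_osup.
  - exact: skc_eval1.
have [K K0 HK] := tight_skc P P' s Z ms DZ VZ _ _ ctot e10.
pose KK := (1 + `|gam| * expR `|gam|) * K.
(* Bounds both [quad] and [sq_int] of a path bounded by [K], so the box contains the point at which
   [h0] is evaluated. *)
pose Kq := (`|rho| * (KK ^+ 2 + 2 * `|gam| * KK ^+ 2) + `|kap|) / 2 + KK ^+ 2.
have [r r0 Hr] := uniform_continuity_box h0 Kq _ ch0 e10.
have r20 : 0 < Num.min (r / 2) del by rewrite lt_min del0 divr_gt0.
have [eta eta0 Hclose] := regression_close K _ (ltW K0) r20.
have del23 : 2 * del < del3 by rewrite /del; lra.
near=> n.
have hYn : forall w, 0 < den n w ->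
     Y1 n w = num n w / Num.sqrt (den n w) /\ Y2 n w = num n w / den n w by near: n.
have hn2 : `|mean P' (fun w => h (G (Z w))) - mean P (fun w => h (G (V n w)))| <= e1.
  by near: n.
have hcl : forall w, osup (V n w) <= K -> `|V n w 1| <= K ->
    `|X0 n w| <= eta * a n -> `|W n w| <= eta ->
    `|quad (OU gam (V n w) 1, sq_int (OU gam (V n w))) - num n w| <= Num.min (r / 2) del /\
    `|sq_int (OU gam (V n w)) - den n w| <= Num.min (r / 2) del by near: n.
pose B1 := [set w | K <= tot (V n w)].
pose B2 := [set w | eta * a n < `|X0 n w|].
pose B3 := [set w | eta * 1 < `|W n w|].
pose B4 := [set w | sq_int (OU gam (V n w)) <= 2 * del].
have mG2V := measurable_step_path _ _ n (s n) _ (ms n) cG2.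
have mW : measurable_fun setT (W n).
  apply: measurable_funB; last exact: measurable_cst.
  apply: measurable_funM; first exact: measurable_cst.
  by apply: measurable_sum => k; exact: measurable_funX.
have mB1 : measurable B1.
  by apply: measurable_ge_cst; exact: measurable_step_path.
have mB2 : measurable B2 by exact: measurable_gt_norm.
have mB3 : measurable B3 by exact: measurable_gt_norm.
have mB4 : measurable B4 by exact: measurable_le_cst.
have pB1 : pr P B1 <= e1 by rewrite /B1; near: n; exact: HK.
have pB2 : pr P B2 <= e1 by rewrite /B2; near: n; exact: small_oP_pr.
have pB3 : pr P B3 <= e1.
  by rewrite /B3; near: n; exact: (small_oP_pr W (fun=> 1)).
have pB4 : pr P B4 <= e1 + e1.
  have : pr P B4 <= pr P' [set w | sq_int (OU gam (Z w)) <= del3] + e1.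
    rewrite /B4; near: n; have := portmanteau P P' s Z ms DZ VZ _ _ _ _ cG2 del23 e10.
    by apply: filterS => n [].
  by lra.
have mB12 : measurable (B1 `|` B2) by exact: measurableU.
have mB123 : measurable (B1 `|` B2 `|` B3) by exact: measurableU.
have mB : measurable (B1 `|` B2 `|` B3 `|` B4) by exact: measurableU.
have pB : pr P (B1 `|` B2 `|` B3 `|` B4) <= 5 * e1.
  have := prU P _ _ mB123 mB4; have := prU P _ _ mB12 mB3; have := prU P _ _ mB1 mB2.
  by lra.
have step1 : `|mean P (fun w => F (Y1 n w, Y2 n w)) - mean P (fun w => h (G (V n w)))| <=
    e1 + 2 * M * pr P (B1 `|` B2 `|` B3 `|` B4).
  apply: mean_close => //.
  - exact: (measurable_step_path _ _ n (s n) _ (ms n) ck).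
  - by move=> w; exact: FM.
  - exact: ltW.
  move=> w nB.
  have : ~ B1 w /\ ~ B2 w /\ ~ B3 w /\ ~ B4 w.
    by split; [|split; [|split]] => b; apply: nB; [left; left; left|left; left; right|left; right|right].
  rewrite /B1 /B2 /B3 /B4 /= => -[/negP b1 [/negP b2 [/negP b3 /negP b4]]].
  rewrite -ltNge /tot gt_max in b1; rewrite -leNgt in b2; rewrite -leNgt mulr1 in b3.
  rewrite -ltNge in b4; case/andP: b1 => oK V1K.
  have [c1 c2] := hcl w (ltW oK) (ltW V1K) b2 b3.
  move: c1 c2; rewrite !le_min => /andP[c1 _] /andP[c2 c3].
  have dpos : del < den n w.
    by move: c3; rewrite ler_distl => /andP[]; lra.
  have [-> ->] := hYn w (lt_trans del0 dpos).
  have -> : (num n w / Num.sqrt (den n w), num n w / den n w) = ratio del (num n w, den n w).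
    by rewrite /ratio/= max_l// ltW.
  have cVw : cadlag (V n w) by exact: step_path_cadlag.
  have VM t : 0 <= t < 1 -> `|V n w t| <= K.
    by move=> t01; apply: le_trans (ltW oK); exact: le_osup.
  have OK t : 0 <= t <= 1 -> `|OU gam (V n w) t| <= KK.
    move=> t01; apply: OU_bound => //; first exact: cadlag_bdm.
    case/andP: (t01) => t0.
    by rewrite le_eqVlt => /predU1P[->|t1]; [exact: ltW|apply: VM; rewrite t0].
  have KK0 : 0 <= KK by apply: le_trans (OK 0 _); rewrite ?lexx ?ler01.
  have G1K : `|OU gam (V n w) 1| <= KK by apply: OK; rewrite ler01 lexx.
  have G2K : sq_int (OU gam (V n w)) <= KK ^+ 2.
    apply: sq_int_le => //; first by apply: cadlag_bdm; exact: OU_cadlag.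
    by move=> t /andP[t0 t1]; apply: OK; rewrite t0 ltW.
  have G20 := @sq_int_ge0 R (OU gam (V n w)).
  have KK2 := sqr_ge0 KK.
  have gK0 : 0 <= 2 * `|gam| * KK ^+ 2 by apply: mulr_ge0 => //; exact: mulr_ge0.
  have rK0 : 0 <= `|rho| * (KK ^+ 2 + 2 * `|gam| * KK ^+ 2) by rewrite mulr_ge0// addr_ge0.
  have qK : `|quad (G (V n w))| <= Kq.
    rewrite /quad /= normrM [`|2^-1|]ger0_norm ?invr_ge0//.
    have h1 : `|OU gam (V n w) 1 ^+ 2 + 2 * gam * sq_int (OU gam (V n w))| <=
        KK ^+ 2 + 2 * `|gam| * KK ^+ 2.
      rewrite (le_trans (ler_normD _ _))// lerD//.
        by rewrite normrX lerXn2r// nnegrE.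
      by rewrite !normrM (ger0_norm G20) ger0_norm// ler_wpM2l// mulr_ge0.
    have h2 : `|rho * (OU gam (V n w) 1 ^+ 2 + 2 * gam * sq_int (OU gam (V n w))) - kap| <=
        `|rho| * (KK ^+ 2 + 2 * `|gam| * KK ^+ 2) + `|kap|.
      by rewrite (le_trans (ler_normB _ _))// lerD2r normrM ler_wpM2l.
    by rewrite /Kq; lra.
  have kq : KK ^+ 2 <= Kq by rewrite /Kq lerDr divr_ge0// addr_ge0.
  have G2Kq : `|sq_int (OU gam (V n w))| <= Kq.
    by rewrite ger0_norm//; exact: le_trans G2K kq.
  have c1' : `|quad (G (V n w)) - num n w| < r by apply: le_lt_trans c1 _; lra.
  have c2' : `|sq_int (OU gam (V n w)) - den n w| < r by apply: le_lt_trans c2 _; lra.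
  rewrite distrC; apply/ltW.
  exact: (Hr (quad (G (V n w)), sq_int (OU gam (V n w))) (num n w, den n w)).
set A := mean P' (fun w => F (scaleR2 (quad (G (Z w))) (Theta (OU gam (Z w))))) in step3 *.
set C := mean P (fun w => F (Y1 n w, Y2 n w)) in step1 *.
set A' := mean P' _ in step3 hn2; set C' := mean P _ in step1 hn2.
have -> : A - C = - (A' - A) + (A' - C') - (C - C') by ring.
rewrite (le_trans (ler_normB _ _))//.
have := ler_normD (- (A' - A)) (A' - C'); rewrite normrN => tri.
have q1 : 2 * M * pr P (B1 `|` B2 `|` B3 `|` B4) <= 2 * M * (5 * e1).
  by rewrite ler_wpM2l// mulr_ge0.
have q3 : 2 * M * pr P' [set w | sq_int (OU gam (Z w)) <= del3] <= 2 * M * e1.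
  by rewrite ler_wpM2l// mulr_ge0.
have Me : 0 <= M * e1 by rewrite mulr_ge0// ltW.
rewrite -e1E.
by lra.
Unshelve. all: by end_near. Qed.

End Regression.

(** * From the common limit to the stated normings *)

Section Studentize.
Context {R : realType}.
Implicit Types (A Q b m r : R).

(** The denominator of the common theorem is [r^2 * Q], with [r = 1 / (sqrt n * a_n)] in cases (i)
    and (iii) and [r = 1 / n] in case (ii). *)
Lemma studentizeE A Q b m r : 0 < r -> 0 < Q ->
  m * (A - b * Q) / Num.sqrt (r ^+ 2 * Q) = m / r * (Num.sqrt Q * (A / Q - b)) /\
  m * (A - b * Q) / (r ^+ 2 * Q) = m / r ^+ 2 * (A / Q - b).
Proof.
move=> r0 Q0; have rn0 := lt0r_neq0 r0; have Qn0 := lt0r_neq0 Q0.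
split; last by field; apply/andP; split.
rewrite sqrtrM ?sqr_ge0// sqrtr_sqr gtr0_norm//.
have s0 : 0 < Num.sqrt Q by rewrite sqrtr_gt0.
have QE : Q = Num.sqrt Q ^+ 2 by rewrite sqr_sqrtr// ltW.
move: (Num.sqrt Q) s0 QE => q q0 ->.
by field; apply/andP; split=> //; exact: lt0r_neq0.
Qed.

End Studentize.

Section SmallIncrements.
Context {R : realType} {d} {T : measurableType d} (P : probability T R).
Variables (a : nat -> R) (eps : nat -> T -> R).

(** The square of the last innovation is dominated by the whole sum of squares. *)
Lemma small_increments :
  (forall n, 0 < a n) -> (forall k, measurable_fun setT (eps k)) ->
  small_oP P (fun n w => \sum_(1 <= k < n.+1) eps k w ^+ 2) (fun n => a n ^+ 2) ->
  forall e, 0 < e -> \forall n \near \oo, exists2 B, measurable B & pr P B <= e /\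
     forall w, ~ B w -> `|\sum_(1 <= k < n.+1) eps k w - \sum_(1 <= k < n.-1.+1) eps k w|
       <= e * a n.
Proof.
move=> a0 meps hs e e0; have e20 : 0 < e ^+ 2 by rewrite exprn_gt0.
near=> n; have n0 : (0 < n)%N by near: n; exact: nbhs_infty_gt.
exists [set w | e ^+ 2 * a n ^+ 2 < `|\sum_(1 <= k < n.+1) eps k w ^+ 2|].
  apply: measurable_gt_norm; apply: measurable_sum => k; exact: measurable_funX.
split; first by near: n; exact: (small_oP_pr P _ _ _ _ hs).
move=> w /= /negP; rewrite -leNgt prednK// => H.
rewrite big_nat_recr//= addrAC subrr add0r.
have ean : 0 <= e * a n by rewrite mulr_ge0// ltW.
rewrite -(ler_pXn2r (ltn0Sn 1)) ?nnegrE// exprMn real_normK ?num_real//.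
apply: le_trans H; rewrite big_nat_recr//= ger0_norm; last first.
  by rewrite addr_ge0 ?sqr_ge0// sumr_ge0// => k _; exact: sqr_ge0.
by rewrite lerDr sumr_ge0// => k _; exact: sqr_ge0.
Unshelve. all: by end_near. Qed.

End SmallIncrements.

Theorem theorem2p1 (R : realType)
  (d : measure_display) (T : measurableType d) (P : probability T R)
  (sigma2 : R) (a : nat -> R) (gamma : R) (beta : nat -> R)
  (eps : nat -> T -> R) (X0 : nat -> T -> R)
  (d' : measure_display) (T' : measurableType d') (P' : probability T' R)
  (Z : T' -> R -> R) :
  0 <= sigma2 ->
  (forall n, 0 < a n) ->
  (n%:R * (1 - beta n)) @[n --> \oo] --> gamma ->
  (forall k, measurable_fun setT (eps k)) ->
  (forall n, measurable_fun setT (X0 n)) ->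
  small_oP P X0 a ->
  [/\
   (* (i) *)
   ((a n / Num.sqrt n%:R) @[n --> \oo] --> +oo ->
    DA P a eps P' Z ->
    cvg_dist_R2 P
      (fun n w => ((a n)^-1 * Num.sqrt n%:R * tauhat beta X0 eps n w,
                   n%:R * (bhat beta X0 eps n w - beta n)))
      P'
      (fun w => scaleR2
         (OU gamma (Z w) 1 ^+ 2 / 2 + gamma * sq_int (OU gamma (Z w)))
         (Theta (OU gamma (Z w))))),
   (* (ii) *)
   ((a n / Num.sqrt n%:R) @[n --> \oo] --> (1 : R) ->
    DA' P a sigma2 eps P' Z ->
    cvg_dist_R2 P
      (fun n w => (tauhat beta X0 eps n w,
                   n%:R * (bhat beta X0 eps n w - beta n)))
      P'
      (fun w => scaleR2
         ((OU gamma (Z w) 1 ^+ 2 - sigma2) / 2 + gamma * sq_int (OU gamma (Z w)))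
         (Theta (OU gamma (Z w))))) &
   (* (iii) *)
   ((a n / Num.sqrt n%:R) @[n --> \oo] --> (0 : R) ->
    DA' P a sigma2 eps P' Z ->
    cvg_dist_R2 P
      (fun n w => (a n / Num.sqrt n%:R * tauhat beta X0 eps n w,
                   a n ^+ 2 * (bhat beta X0 eps n w - beta n)))
      P'
      (fun w => scaleR2 (- (sigma2 / 2)) (Theta (OU gamma (Z w)))))].
Proof.
move=> _ a0 hbeta meps mX0 hX0.
have mtau := measurable_tauhat beta eps X0 meps mX0.
have mb n : measurable_fun setT (fun w => bhat beta X0 eps n w - beta n).
  by apply: measurable_funB; [exact: measurable_bhat|exact: measurable_cst].
have msc (c : R) (f : T -> R) : measurable_fun setT f -> measurable_fun setT (fun w => c * f w).
  by move=> mf; apply: measurable_funM => //; exact: measurable_cst.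
have mS := @measurable_partial_sum R d T eps meps.
have sqrtn_sq n : Num.sqrt (n%:R : R) ^+ 2 = n%:R by rewrite sqr_sqrtr.
pose Q n w : R := \sum_(t < n) Xn beta X0 eps n w t ^+ 2.
have denE p n w : p * (n%:R^-1 * \sum_(t < n) (Xn beta X0 eps n w t / a n) ^+ 2) =
    p * n%:R^-1 * (a n)^-1 ^+ 2 * Q n w.
  have -> : \sum_(t < n) (Xn beta X0 eps n w t / a n) ^+ 2 = (a n)^-1 ^+ 2 * Q n w.
    by rewrite /Q mulr_sumr; apply: eq_bigr => t _; rewrite exprMn mulrC.
  by rewrite !mulrA.
have Qpos c n w : 0 < c * Q n w -> 0 < Q n w.
  move=> cQ; have Q0 : 0 <= Q n w by apply: sumr_ge0 => t _; exact: sqr_ge0.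
  by rewrite lt_neqAle Q0 andbT; apply/eqP => E; move: cQ; rewrite -E mulr0 ltxx.
have poly (l : R) : (a n / Num.sqrt n%:R) @[n --> \oo] --> l ->
    \forall n \near \oo, a n <= (`|l| + 1) * n%:R.
  move=> /cvgrPdist_le/(_ _ ltr01) H; near=> n.
  have n0 : (0 < n)%N by near: n; exact: nbhs_infty_gt.
  have n1 : 1 <= n%:R :> R by rewrite ler1n.
  have h : `|l - a n / Num.sqrt n%:R| <= 1 by near: n.
  have sn : 0 < Num.sqrt n%:R :> R by rewrite sqrtr_gt0; lra.
  have sn1 : 1 <= Num.sqrt n%:R :> R by rewrite -[leLHS]sqrtr1 ler_wsqrtr.
  have sle : Num.sqrt n%:R <= n%:R :> R by rewrite -[leRHS]sqrtn_sq expr2 ler_peMl// ltW.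
  have h2 : a n / Num.sqrt n%:R <= `|l| + 1.
    by move: h; rewrite ler_distl => /andP[]; have := ler_norm l; lra.
  rewrite ler_pdivrMr// in h2; apply: le_trans h2 _; rewrite ler_wpM2l// addr_ge0//.
have sqcvg (l : R) : (a n / Num.sqrt n%:R) @[n --> \oo] --> l ->
    n%:R^-1 * a n ^+ 2 @[n --> \oo] --> l * l.
  move=> H; have -> : (fun n => n%:R^-1 * a n ^+ 2) =
      (fun n => (a n / Num.sqrt n%:R) * (a n / Num.sqrt n%:R)).
    by apply/funext => n; rewrite -expr2 exprMn exprVn sqrtn_sq mulrC.
  exact: cvgM.
have smallW (kap : R) : (forall eta : R, 0 < eta ->
    P [set w | eta < `|n%:R^-1 * \sum_(1 <= k < n.+1) eps k w ^+ 2 - kap|]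
      @[n --> \oo] --> 0%E) ->
    small_oP P (fun n w => n%:R^-1 * \sum_(1 <= k < n.+1) eps k w ^+ 2 - kap) (fun=> 1).
  by move=> H eta eta0; rewrite mulr1; exact: H.
split.
- move=> _ [DZ [VZ [Z0 hs]]].
  have J0 := no_end_jump_small_increment P P' a _ Z a0 mS DZ VZ Z0 (small_increments P a eps a0 meps hs).
  have hrho : (a n ^+ 2)^-1 * a n ^+ 2 @[n --> \oo] --> (1 : R).
    by apply: cvg_near_cst; near=> n; rewrite mulVf// expf_neq0// gt_eqF.
  (* (D3) divided by [a n ^+ 2]: the innovations leave no constant, so [kap = 0]. *)
  have hW : small_oP P (fun n w => (a n ^+ 2)^-1 * \sum_(1 <= k < n.+1) eps k w ^+ 2 - 0)
      (fun=> 1).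
    move=> eta eta0; apply: cvg_trans (hs eta eta0); apply: near_eq_cvg; near=> n.
    congr (P _); apply/seteqP; split=> w /=; have an : 0 < a n ^+ 2 by rewrite exprn_gt0.
      by rewrite subr0 mulr1 normrM gtr0_norm ?invr_gt0// ltr_pdivlMl// mulrC.
    by rewrite subr0 mulr1 normrM gtr0_norm ?invr_gt0// ltr_pdivlMl// mulrC.
  have := regression_limit P P' a beta gamma eps X0 Z a0 hbeta meps mX0 hX0
    (fun n => (a n ^+ 2)^-1) (fun=> 1) 1 0 hrho (cvg_cst _) hW DZ VZ J0
    (fun n w => (a n)^-1 * Num.sqrt n%:R * tauhat beta X0 eps n w)
    (fun n w => n%:R * (bhat beta X0 eps n w - beta n))
    (fun n => msc _ _ (mtau n)) (fun n => msc _ _ (mb n)).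
  rewrite (_ : (fun w => scaleR2 _ _) = (fun w => scaleR2
         (OU gamma (Z w) 1 ^+ 2 / 2 + gamma * sq_int (OU gamma (Z w)))
         (Theta (OU gamma (Z w))))); last first.
    by apply/funext => w; congr (scaleR2 _ _) => /=; field.
  apply; near=> n => w; rewrite denE.
  have n0 : (0 < n)%N by near: n; exact: nbhs_infty_gt.
  have n0' : 0 < n%:R :> R by rewrite ltr0n.
  move=> /Qpos Q0; have sn : 0 < Num.sqrt n%:R :> R by rewrite sqrtr_gt0.
  have an := a0 n; have r0 : 0 < (Num.sqrt n%:R * a n)^-1 by rewrite invr_gt0 mulr_gt0.
  rewrite (_ : 1 * _ * _ = (Num.sqrt n%:R * a n)^-1 ^+ 2); last first.
    by move: (sqrtn_sq n) sn; set q := Num.sqrt _ => <- sn; field; rewrite !lt0r_neq0.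
  have [-> ->] := studentizeE (\sum_(t < n) Xn beta X0 eps n w t.+1 * Xn beta X0 eps n w t)
    (Q n w) (beta n) (a n ^+ 2)^-1 _ r0 Q0.
  split; congr (_ * _); first by field; rewrite !lt0r_neq0.
  by move: (sqrtn_sq n) sn; set q := Num.sqrt _ => <- sn; field; rewrite !lt0r_neq0.
- move=> ha [DZ [VZ [Z0 hs]]].
  have J0 := no_end_jump_poly_growth P P' a _ Z a0 mS DZ VZ Z0 _ (poly _ ha).
  (* This limit serves twice, as the one defining [rho] and as [p --> 1]. *)
  have hrho := sqcvg _ ha; rewrite mulr1 in hrho.
  have hW := smallW _ hs.
  have := regression_limit P P' a beta gamma eps X0 Z a0 hbeta meps mX0 hX0
    (fun n => n%:R^-1) (fun n => n%:R^-1 * a n ^+ 2) 1 sigma2 hrho hrho hW DZ VZ J0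
    (tauhat beta X0 eps)
    (fun n w => n%:R * (bhat beta X0 eps n w - beta n))
    mtau (fun n => msc _ _ (mb n)).
  rewrite (_ : (fun w => scaleR2 _ _) = (fun w => scaleR2
         ((OU gamma (Z w) 1 ^+ 2 - sigma2) / 2 + gamma * sq_int (OU gamma (Z w)))
         (Theta (OU gamma (Z w))))); last first.
    by apply/funext => w; congr (scaleR2 _ _) => /=; field.
  apply; near=> n => w; rewrite denE.
  have n0 : (0 < n)%N by near: n; exact: nbhs_infty_gt.
  have n0' : 0 < n%:R :> R by rewrite ltr0n.
  move=> /Qpos Q0; have an := a0 n; have r0 : 0 < n%:R^-1 :> R by rewrite invr_gt0.
  rewrite (_ : _ * _ * _ ^+ 2 = n%:R^-1 ^+ 2); last by field; rewrite !lt0r_neq0.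
  have [-> ->] := studentizeE (\sum_(t < n) Xn beta X0 eps n w t.+1 * Xn beta X0 eps n w t)
    (Q n w) (beta n) n%:R^-1 _ r0 Q0.
  split; first by rewrite divff ?mul1r// gt_eqF.
  by congr (_ * _); field; rewrite !lt0r_neq0.
- move=> ha [DZ [VZ [Z0 hs]]].
  have J0 := no_end_jump_poly_growth P P' a _ Z a0 mS DZ VZ Z0 _ (poly _ ha).
  (* With [rho = 0] the Ornstein-Uhlenbeck terms leave the numerator and only [- sigma2 / 2]
     remains. *)
  have hrho := sqcvg _ ha; rewrite mulr0 in hrho.
  have hW := smallW _ hs.
  have := regression_limit P P' a beta gamma eps X0 Z a0 hbeta meps mX0 hX0
    (fun n => n%:R^-1) (fun=> 1) 0 sigma2 hrho (cvg_cst _) hW DZ VZ J0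
    (fun n w => a n / Num.sqrt n%:R * tauhat beta X0 eps n w)
    (fun n w => a n ^+ 2 * (bhat beta X0 eps n w - beta n))
    (fun n => msc _ _ (mtau n)) (fun n => msc _ _ (mb n)).
  rewrite (_ : (fun w => scaleR2 _ _) = (fun w => scaleR2 (- (sigma2 / 2))
         (Theta (OU gamma (Z w))))); last first.
    by apply/funext => w; congr (scaleR2 _ _) => /=; field.
  apply; near=> n => w; rewrite denE.
  have n0 : (0 < n)%N by near: n; exact: nbhs_infty_gt.
  have n0' : 0 < n%:R :> R by rewrite ltr0n.
  move=> /Qpos Q0; have sn : 0 < Num.sqrt n%:R :> R by rewrite sqrtr_gt0.
  have an := a0 n; have r0 : 0 < (Num.sqrt n%:R * a n)^-1 by rewrite invr_gt0 mulr_gt0.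
  rewrite (_ : 1 * _ * _ = (Num.sqrt n%:R * a n)^-1 ^+ 2); last first.
    by move: (sqrtn_sq n) sn; set q := Num.sqrt _ => <- sn; field; rewrite !lt0r_neq0.
  have [-> ->] := studentizeE (\sum_(t < n) Xn beta X0 eps n w t.+1 * Xn beta X0 eps n w t)
    (Q n w) (beta n) n%:R^-1 _ r0 Q0.
  split; congr (_ * _); first by move: (sqrtn_sq n) sn; set q := Num.sqrt _ => <- sn; field; rewrite !lt0r_neq0.
  by move: (sqrtn_sq n) sn; set q := Num.sqrt _ => <- sn; field; rewrite !lt0r_neq0.
Unshelve. all: by end_near. Qed.
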